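(* For each positive integer $p$ put $q=2^p$, $N=2^p-1$, $s=\lceil N^{1/3}\rceil$ and $m=N+ps$. Let $\alpha_1,\dots,\alpha_N$ be an enumeration of all nonzero elements of $\mathbb F_{2^p}$, fix a basis of $\mathbb F_{2^p}$ over $\mathbb Z_2$, and let $U$ be the $N\times ps$ matrix over $\mathbb Z_2$ obtained from the $N\times s$ matrix $(\alpha_k^t)_{1\le k\le N,\,1\le t\le s}$ over $\mathbb F_{2^p}$ by replacing each entry with the row of its $p$ coordinates in the fixed basis. Let $$A=\begin{pmatrix} U & I_N\\ I_{ps} & U^T\end{pmatrix},$$ an $m\times m$ matrix over $\mathbb Z_2$. Then for all sufficiently large $p$ the matrix $A$ is invertible, i.e. $A\in \mathrm{GL}(m,\mathbb Z_2)$, and, as $p\to\infty$, $$\lambda_m(A)\ \ge\ 4m-o(m)\qquad\text{and}\qquad \ell_m(A)\ \ge\ 4m-o(m).$$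
   Context: $\mathbb Z_2$ is the field with two elements and $\mathbb F_{2^p}$ is the field with $2^p$ elements, regarded as a $p$-dimensional vector space over $\mathbb Z_2$. CNOT length: for $A\in \mathrm{GL}(n,\mathbb Z_2)$, $\ell_n(A)$ is the minimal number of transvections (elementary matrices of the type that adds one row to another row) whose product is $A$. 2-local gate length: for $1\le i<j\le n$ and $B\in \mathrm{GL}(2,\mathbb Z_2)$, let $p_{ij}(B)\in \mathrm{GL}(n,\mathbb Z_2)$ be the linear map that applies $B$ to the coordinates $(x_i,x_j)$ of $x=(x_1,\dots,x_n)$ and fixes all other coordinates. Then $\lambda_n(A)$ is the minimal number of matrices of the form $p_{ij}(B)$ whose product is $A$. (The empty product is the identity.) The matrix $U$: its columns are indexed by pairs $(t,i)$ with $1\le t\le s$, $1\le i\le p$, and its entry in row $k$ and column $(t,i)$ is $\phi_i(\alpha_k^t)$, where $\phi_1,\dots,\phi_p:\mathbb F_{2^p}\to\mathbb Z_2$ are the coordinate maps of the fixed basis. The $o(m)$ terms refer to $p\to\infty$ (equivalently $m\to\infty$). *)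

(* Defs.v *)
From HB Require Import structures.
From mathcomp Require Import all_boot all_order all_algebra all_field.
From mathcomp Require Import all_classical all_reals all_analysis.
Set Implicit Arguments.
Unset Strict Implicit.
Unset Printing Implicit Defensive.
Import Order.TTheory GRing.Theory Num.Theory.
Import numFieldNormedType.Exports.

Local Open Scope ring_scope.

Section GateLength.
Variable n : nat.
Implicit Types (S : {set 'M['F_2]_n}) (A : 'M['F_2]_n) (k : nat).

Definition is_product S A k : bool :=
  [exists gs : k.-tuple 'M['F_2]_n, all (mem S) gs && (\prod_(g <- gs) g == A)].

(* The default value 0 only concerns matrices that are not products of
   elements of S.  Both gate sets below generate GL(n, Z_2), so it never
   occurs there on an invertible matrix; in a lower bound such as the one
   stated here it could only make the claim harder. *)
Definition gate_length S A : nat :=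
  if pselect (exists k, is_product S A k) is left h then ex_minn h else 0%N.

(* Left multiplication by 1 + E_ij adds row j to row i. *)
Definition transvections : {set 'M['F_2]_n} :=
  [set g | [exists i : 'I_n, exists j : 'I_n,
              (i != j) && (g == 1%:M + delta_mx i j)]].

(* Acting on column vectors: (x_i, x_j) is sent to B (x_i, x_j), and the other
   coordinates are fixed (only used for i < j). *)
Definition two_local (i j : 'I_n) (B : 'M['F_2]_2) : 'M['F_2]_n :=
  \matrix_(a, b)
    if a == i then
      if b == i then B 0 0 else if b == j then B 0 1 else 0
    else if a == j then
      if b == i then B 1 0 else if b == j then B 1 1 else 0
    else (a == b)%:R.

Definition two_local_gates : {set 'M['F_2]_n} :=
  [set g | [exists i : 'I_n, exists j : 'I_n, exists B : 'M['F_2]_2,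
              [&& (i < j)%N, B \in unitmx & g == two_local i j B]]].

Definition cnot_length A : nat := gate_length transvections A.
Definition two_local_length A : nat := gate_length two_local_gates A.

End GateLength.

Definition dimN (p : nat) : nat := (2 ^ p - 1)%N.

Definition dims (R : realType) (p : nat) : nat :=
  `|Num.ceil ((dimN p)%:R `^ (3%:R^-1) : R)|%N.

Definition dimm (R : realType) (p : nat) : nat := (dimN p + dims R p * p)%N.

Section Matrices.
Variables (L : fieldExtType 'F_2) (N s p : nat).
Variables (alpha : 'I_N -> L) (b : p.-tuple L).

(* mxvec concatenates rows, so the column of index (t, i) is number t * p + i
   (all indices from 0): the p coordinates of alpha_k, then those of
   alpha_k ^ 2, and so on.  Index t : 'I_s stands for the exponent t + 1. *)
Definition Umx : 'M['F_2]_(N, s * p) :=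
  \matrix_(k < N) mxvec (\matrix_(t < s, i < p) coord b i (alpha k ^+ t.+1)).

Definition Amx : 'M['F_2]_(N + s * p) :=
  castmx (erefl, addnC (s * p)%N N) (block_mx Umx 1%:M 1%:M Umx^T).

End Matrices.

(* Main.v *)
(** A two-local gate computes at most one new XOR of two wires, so a product of
[k] gates equal to [A] gives a straight-line program of at most [k] XOR gates,
in which every value is either used by a later gate or is an output.  Write the
inputs as [(a, b)], with [a] of length [p s = o(N)] and [b] of length [N]; the
program computes [y_k = b_k + U_k a] for each [k], and [w = a + U^T b].  By the
Vandermonde argument any [s] rows of [U] are linearly independent.

Each gate is a relation between three vertices.  Declare [b_k] and [y_k] known,
except when [b_k] is used once and [y_k] is never used; in that case identify
[b_k] with [y_k], and declare known the end of the chain of singly used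
vertices that starts at [b_k].  A nonempty set of at most [s/3] relations cannot
sum to a relation between known vertices: the last known chain end involved has
a nonzero coefficient at its own [b_k], and without chain ends this is a short
relation between the [b_k] and the [y_k].

There are [2N] known vertices, they have total degree at least [3N - o(N)], and
almost all other vertices have degree at least 2.  Close the known vertices
under "a relation with a single unknown vertex makes it known", for a bounded
number of steps; the relations left with two unknown vertices form a graph
without short cycles, hence with at most [1 + o(1)] edges per vertex.  Counting
degrees gives [3N <= (1 + o(1)) (G + N - 2N) + o(N)], that is [G >= 4N - o(N)].

Invertibility follows from [U^T U = 0]: the entries of [U^T U] are coordinates
of the power sums of exponents [t + t' 2^w] over the nonzero elements of the
field, which vanish since [t, t' <= s] are small. *)
Require Import Defs.
From HB Require Import structures.
From mathcomp Require Import all_boot all_order all_algebra all_field.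
From mathcomp Require Import fingroup perm zify lra.
Set Implicit Arguments.
Unset Strict Implicit.
Unset Printing Implicit Defensive.
Import Order.TTheory GRing.Theory Num.Theory.

Local Open Scope ring_scope.

(** * Short dependencies in set systems over the two-element field *)

Lemma F2_cases (x : 'F_2) : x = 0 \/ x = 1.
Proof. by case: x => -[|[|//]] i; [left|right]; apply: val_inj. Qed.

Lemma F2_neq0 (x : 'F_2) : x != 0 -> x = 1.
Proof. by case: (F2_cases x) => -> //; rewrite eqxx. Qed.

Section Weight.
Variable I : finType.
Implicit Types q : {ffun I -> 'F_2}.

Definition wt q : nat := #|[set i | q i != 0]|.

Arguments wt q%_R.

Lemma wt0 : wt 0 = 0%N.
Proof. by apply/eqP; rewrite cards_eq0; apply/eqP/setP => i; rewrite !inE ffunE eqxx. Qed.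

Lemma wtD q1 q2 : (wt (q1 + q2) <= wt q1 + wt q2)%N.
Proof.
apply: leq_trans (leq_card_setU _ _); apply/subset_leq_card/subsetP => i.
by rewrite !inE ffunE; case: (eqVneq (q1 i) 0) => //= ->; rewrite add0r.
Qed.

Lemma wt_sum (J : finType) (P : pred J) (F : J -> {ffun I -> 'F_2}) n :
  (forall j, P j -> (wt (F j) <= n)%N) -> (wt (\sum_(j | P j) F j) <= #|P| * n)%N.
Proof.
move=> le_n; rewrite -sum_nat_const; elim/big_rec2: _ => [|j k q Pj IH]; first by rewrite wt0.
by apply: leq_trans (wtD _ _) _; rewrite leq_add // le_n.
Qed.

Definition unit_at (i : I) : {ffun I -> 'F_2} := [ffun j => (j == i)%:R].

Lemma wt_unit i : wt (unit_at i) = 1%N.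
Proof.
rewrite -(cards1 i); apply: eq_card => j.
by rewrite !inE ffunE; case: (j == i); rewrite ?oner_neq0 ?eqxx.
Qed.

End Weight.

Section Incidence.
Variables X I : finType.
Implicit Types (T : I -> {set X}) (J : {set I}) (q : {ffun I -> 'F_2}) (K : {set X}).

Definition supported J q := forall i, i \notin J -> q i = 0.

(** The coordinate at [x] of the symmetric difference of the sets [T i] selected by [q]. When all
    sets have two elements this is the boundary map of a graph. *)
Definition bdry T q x : 'F_2 := \sum_i q i * (x \in T i)%:R.

Lemma bdryD T q1 q2 x : bdry T (q1 + q2) x = bdry T q1 x + bdry T q2 x.
Proof. by rewrite -big_split; apply: eq_bigr => i _; rewrite ffunE mulrDl. Qed.

Lemma bdry0 T x : bdry T 0 x = 0.
Proof. by rewrite /bdry big1 // => i _; rewrite ffunE mul0r. Qed.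

Lemma bdry_sum T (A : finType) (P : pred A) (F : A -> {ffun I -> 'F_2}) x :
  bdry T (\sum_(a | P a) F a) x = \sum_(a | P a) bdry T (F a) x.
Proof. by apply: (big_morph (fun q => bdry T q x)) => [q1 q2|]; rewrite ?bdryD ?bdry0. Qed.

Lemma bdry_unit T i x : bdry T (unit_at i) x = (x \in T i)%:R.
Proof.
rewrite /bdry (bigD1 i) //= ffunE eqxx mul1r big1 ?addr0 // => j /negPf ji.
by rewrite ffunE ji mul0r.
Qed.

Lemma supported_unit J i : i \in J -> supported J (unit_at i).
Proof. by move=> Ji j; rewrite ffunE; case: eqP => // ->; rewrite Ji. Qed.

Lemma supported_sum J (A : finType) (P : pred A) (F : A -> {ffun I -> 'F_2}) :
  (forall a, P a -> supported J (F a)) -> supported J (\sum_(a | P a) F a).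
Proof. by move=> sF i Ji; rewrite sum_ffunE big1 // => a Pa; rewrite sF. Qed.

Lemma supportedD J q1 q2 : supported J q1 -> supported J q2 -> supported J (q1 + q2).
Proof. by move=> s1 s2 i Ji; rewrite ffunE s1 // s2 // addr0. Qed.

Lemma supportedS J1 J2 q : J1 \subset J2 -> supported J1 q -> supported J2 q.
Proof. by move=> /subsetP sJ s1 i Ji; apply: s1; apply: contra Ji; apply: sJ. Qed.

(** In coding terms: with the coordinates in [K] erased, the sets [T i] for [i] in [J] are the
    columns of a parity check matrix of minimum distance greater than [n]. *)
Definition no_short_dependency T J K n :=
  forall q, supported J q -> (forall x, x \notin K -> bdry T q x = 0) ->
  (wt q <= n)%N -> q = 0.

(** For sets of two elements, the iterates starting from a single vertex are the balls around it in
    a graph; [sparse_graph] relies on this reading. *)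
Definition grow T J K :=
  K :|: [set x | [exists i in J, (x \in T i) && (T i :\ x \subset K)]].

Section Closure.
Variables (T : I -> {set X}) (J : {set I}) (K0 : {set X}) (d : nat).
Hypothesis d_gt0 : (0 < d)%N.
Hypothesis T_le : forall i, i \in J -> (#|T i| <= d.+1)%N.

Definition level n := iter n (grow T J) K0.

Lemma level_sub n : level n \subset level n.+1.
Proof. exact: subsetUl. Qed.

Lemma level0_sub n : K0 \subset level n.
Proof. by elim: n => // n IH; apply: subset_trans IH (level_sub n). Qed.

(* Bounds the number of sets needed to solve for an element of [level n]. *)
Fixpoint cost n := if n is n'.+1 then (d * cost n').+1 else 0%N.

Lemma cost_mono n : (cost n <= cost n.+1)%N.
Proof. by rewrite /= (leq_trans (leq_pmull _ d_gt0)). Qed.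

(** Each element added by a step of [grow] is charged to one set that contains it and is otherwise
    already solved; [E] collects these sets. Adding that set to the solutions of its other elements
    isolates the new element modulo [K0]. *)
Lemma level_solved n : exists E : {set I},
  [/\ E \subset J, (#|E| <= #|level n :\: K0|)%N,
      forall i, i \in E -> T i \subset level n &
      forall x, x \in level n -> exists q,
        [/\ (wt q <= cost n)%N, supported E q &
            forall z, z \notin K0 -> bdry T q z = (z == x)%:R]].
Proof.
elim: n => [|n [E [EJ cE inE' solE]]].
  exists set0; split; rewrite ?sub0set ?cards0 //; first by move=> i; rewrite inE.
  move=> x Kx.
  exists 0; split; rewrite ?wt0 //; first by move=> i _; rewrite ffunE.
  by move=> z; rewrite bdry0; case: eqP => // ->; rewrite Kx.
set D := level n.+1 :\: level n.
have [D0|[x0 Dx0]] := set_0Vmem D.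
  have eqL : level n.+1 = level n.
    by apply/eqP; rewrite eqEsubset level_sub andbT -setD_eq0 -/D D0.
  exists E; rewrite eqL; split=> // x /solE[q [wq sq bq]].
  by exists q; split=> //; apply: leq_trans wq (cost_mono n).
pose ok x i := [&& i \in J, x \in T i & T i :\ x \subset level n].
have exok x : x \in D -> exists i, ok x i.
  by rewrite !inE => /andP[/negPf->] /= /exists_inP[i Ji Px]; exists i; rewrite /ok Ji.
have [i0 _] := exok _ Dx0.
(* [i0] is only a default value, for arguments outside [D]. *)
pose e x := odflt i0 [pick i | ok x i].
have eP x : x \in D -> ok x (e x).
  by move=> /exok[i oki]; rewrite /e; case: pickP => [//|/(_ i)]; rewrite oki.
exists (E :|: e @: D); split.
- rewrite subUset EJ; apply/subsetP => _ /imsetP[x /eP/and3P[Jx _ _] ->] //.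
- apply: leq_trans (leq_card_setU _ _) _.
  have -> : level n.+1 :\: K0 = (level n :\: K0) :|: D.
    apply/setP => x; rewrite inE [in RHS]inE ![x \in _ :\: _]inE.
    have := subsetP (level_sub n) x; have := subsetP (level0_sub n) x.
    by case: (x \in level n); case: (x \in K0); case: (x \in level n.+1) => // H1 H2;
       first [by move: (H1 isT) | by move: (H2 isT)].
  have /leqifP := leq_card_setU (level n :\: K0) D.
  rewrite ifT; last first.
    by rewrite -setI_eq0; apply/eqP/setP => x; rewrite !inE; case: (x \in level n); rewrite ?andbF.
  by move=> /eqP ->; rewrite leq_add // leq_imset_card.
- move=> i; rewrite inE => /orP[/inE' s|/imsetP[x Dx ->]].
    exact: subset_trans s (level_sub n).
  have /and3P[_ Tx s] := eP x Dx; rewrite -(setD1K Tx) subUset (subset_trans s (level_sub n)) andbT.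
  by rewrite sub1set; move: Dx; rewrite inE => /andP[].
- move=> x Kx; have [Lx|nLx] := boolP (x \in level n).
    have [q [wq sq bq]] := solE x Lx; exists q; split=> //.
      exact: leq_trans wq (cost_mono n).
    by apply: supportedS sq; apply: subsetUl.
  have Dx : x \in D by rewrite inE nLx.
  have /and3P[Jx Tx sx] := eP x Dx.
  have /fin_all_exists[Q QP] : forall z, exists q, z \in level n ->
      [/\ (wt q <= cost n)%N, supported E q &
          forall u, u \notin K0 -> bdry T q u = (u == z)%:R].
    move=> z; have [/solE[q qP]|_] := boolP (z \in level n); first by exists q.
    by exists 0.
  have QP' z : z \in T (e x) :\ x -> [/\ (wt (Q z) <= cost n)%N, supported E (Q z) &
          forall u, u \notin K0 -> bdry T (Q z) u = (u == z)%:R].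
    by move=> /(subsetP sx)/QP.
  exists (unit_at (e x) + \sum_(z in T (e x) :\ x) Q z); split.
  + apply: leq_trans (wtD _ _) _; rewrite wt_unit add1n ltnS.
    apply: leq_trans (wt_sum (n := cost n) _) _; first by move=> z /QP'[].
    by rewrite leq_mul2r; have := T_le Jx; rewrite (cardsD1 x) Tx ltnS => ->; rewrite orbT.
  + apply: supportedD; first by apply: supported_unit; rewrite inE imset_f ?orbT.
    by apply: supported_sum => z /QP'[_ s _]; apply: supportedS s; apply: subsetUl.
  + move=> u Ku; rewrite bdryD bdry_unit bdry_sum.
    rewrite (eq_bigr (fun z => if z == u then 1 else 0)); last first.
      by move=> z /QP'[_ _ ->] //; rewrite eq_sym; case: eqP.
    rewrite -big_mkcondr /= big_mkcond /= (bigD1 u) //= eqxx andbT.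
    rewrite big1 => [|z /negPf ->]; last by rewrite andbF.
    rewrite !inE addr0; case: (eqVneq u x) => [->|_] /=; first by rewrite Tx addr0.
    by case: ifP => _; [apply/val_inj | rewrite addr0].
Qed.

(** A set inside the level whose index is not in [E] would, together with the solutions of its
    elements, be a nonzero dependency of weight at most [1 + d.+1 * cost n]. Hence all these indices
    lie in [E]. *)
Lemma inner_rows n M : no_short_dependency T J K0 M ->
  (d.+1 * cost n < M)%N ->
  (#|[set i in J | T i \subset level n]| <= #|level n :\: K0|)%N.
Proof.
move=> nsd leM; have [E [EJ cE _ solE]] := level_solved n.
apply: leq_trans cE; apply/subset_leq_card/subsetP => i; rewrite inE => /andP[Ji si].
apply: contraT => nEi.
have /fin_all_exists[Q QP] : forall z, exists q, z \in T i ->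
    [/\ (wt q <= cost n)%N, supported E q &
        forall u, u \notin K0 -> bdry T q u = (u == z)%:R].
  move=> z; have [/(subsetP si)/solE[q qP]|_] := boolP (z \in T i); first by exists q.
  by exists 0.
pose q := unit_at i + \sum_(z in T i) Q z.
have sQ : supported E (\sum_(z in T i) Q z) by apply: supported_sum => z /QP[].
have q0 : q = 0.
  apply: nsd.
  - apply: supportedD; first exact: supported_unit.
    exact: supportedS EJ sQ.
  - move=> u Ku; rewrite bdryD bdry_unit bdry_sum.
    rewrite (eq_bigr (fun z => if z == u then 1 else 0)); last first.
      by move=> z /QP[_ _ ->] //; rewrite eq_sym; case: eqP.
    rewrite -big_mkcondr /= big_mkcond /= (bigD1 u) //= eqxx andbT.
    rewrite big1 => [|z /negPf ->]; last by rewrite andbF.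
    by rewrite addr0; case: ifP => _; [apply/val_inj | rewrite addr0].
  - apply: leq_trans (wtD _ _) _; rewrite wt_unit add1n.
    apply: leq_trans leM; rewrite ltnS.
    apply: leq_trans (wt_sum (n := cost n) _) _; first by move=> z /QP[].
    by rewrite leq_mul2r T_le ?orbT.
have := congr1 (fun f : {ffun I -> 'F_2} => f i) q0.
by rewrite !ffunE eqxx sQ // addr0.
Qed.

(** A dependency modulo the level becomes one modulo [K0] after adding the solutions of all level
    elements it meets, which multiplies its weight by at most [(d.+1 * cost n).+1]. *)
Lemma outer_rows n M L : no_short_dependency T J K0 M ->
  (L * (d.+1 * cost n).+1 <= M)%N ->
  no_short_dependency T [set i in J | ~~ (T i \subset level n)] (level n) L.
Proof.
move=> nsd leM q sq bq wq; have [E [EJ cE inE' solE]] := level_solved n.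
have /fin_all_exists[Q QP] : forall z, exists q, z \in level n ->
    [/\ (wt q <= cost n)%N, supported E q &
        forall u, u \notin K0 -> bdry T q u = (u == z)%:R].
  move=> z; have [/solE[q' qP]|_] := boolP (z \in level n); first by exists q'.
  by exists 0.
pose P i := q i != 0.
have PJ i : P i -> (i \in J) && ~~ (T i \subset level n).
  by move=> Pi; apply: contraR Pi => nJ; rewrite /P sq ?eqxx // inE.
pose r i := \sum_(z in T i :&: level n) Q z.
have rP i : P i -> [/\ (wt (r i) <= d.+1 * cost n)%N, supported E (r i) &
    forall u, u \notin K0 -> bdry T (r i) u = (u \in T i :&: level n)%:R].
  move=> Pi; have QP' z : z \in T i :&: level n -> [/\ (wt (Q z) <= cost n)%N, supported E (Q z) &
        forall u, u \notin K0 -> bdry T (Q z) u = (u == z)%:R].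
    by rewrite inE => /andP[_ /QP].
  split.
  - apply: leq_trans (wt_sum (n := cost n) _) _; first by move=> z /QP'[].
    have /andP[Ji _] := PJ i Pi.
    by rewrite leq_mul2r (leq_trans _ (T_le Ji)) ?orbT // subset_leq_card // subsetIl.
  - by apply: supported_sum => z /QP'[].
  - move=> u Ku; rewrite bdry_sum.
    rewrite (eq_bigr (fun z => if z == u then 1 else 0)); last first.
      by move=> z /QP'[_ _ ->] //; rewrite eq_sym; case: eqP.
    rewrite -big_mkcondr /= big_mkcond /= (bigD1 u) //= eqxx andbT.
    rewrite big1 => [|z /negPf ->]; last by rewrite andbF.
    by rewrite addr0; case: ifP.
have sR : supported E (\sum_(i | P i) r i) by apply: supported_sum => i /rP[].
have q0 : q + \sum_(i | P i) r i = 0.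
  apply: nsd.
  - apply: supportedD; last exact: supportedS EJ sR.
    by apply: supportedS sq; apply/subsetP => i; rewrite inE => /andP[].
  - move=> u Ku; rewrite bdryD bdry_sum; have [Lu|nLu] := boolP (u \in level n); last first.
      rewrite bq // add0r big1 // => i /rP[_ _ ->] //.
      by rewrite inE (negPf nLu) andbF.
    rewrite {1}/bdry (bigID P) /= [X in _ + X + _]big1 ?addr0; last first.
      by move=> i; rewrite /P negbK => /eqP ->; rewrite mul0r.
    rewrite -big_split big1 //= => i Pi; have [_ _ ->] // := rP i Pi.
    rewrite inE Lu andbT (F2_neq0 Pi) mul1r.
    by case: (u \in T i); rewrite ?addr0 //; apply/val_inj.
  - apply: leq_trans leM; rewrite mulnS; apply: leq_trans (wtD _ _) _.
    apply: leq_add => //.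
    apply: leq_trans (wt_sum (n := d.+1 * cost n) _) _; first by move=> i /rP[].
    rewrite leq_mul2r; apply/orP; right; apply: leq_trans wq.
    by apply: eq_leq; apply: eq_card => i; rewrite inE.
(* The corrections are supported in [E], so an index with [q i] nonzero can only cancel if it lies
   in [E]; but the sets of [E] are contained in the level. *)
apply/ffunP => i; rewrite ffunE; apply/eqP; apply: contraT => qi.
have /andP[_ /negP[]] := PJ i qi.
apply: inE'; apply: contraT => nEi.
have := congr1 (fun f : {ffun I -> 'F_2} => f i) q0.
by rewrite !ffunE sR // addr0 => /eqP; rewrite (negPf qi).
Qed.

End Closure.
End Incidence.

(** * Graphs without short cycles *)

Lemma bernoulli_nat h n : (h ^ n * (h + n) <= h * h.+1 ^ n)%N.
Proof.
elim: n => [|n IH]; first by rewrite !expn0 mul1n addn0 muln1.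
rewrite !expnS [in leqRHS]mulnCA.
apply: leq_trans (leq_mul (leqnn h.+1) IH); nia.
Qed.

Lemma geometric_growth h l (a : nat -> nat) : (0 < h)%N -> (0 < a 0%N)%N ->
  (forall j, (j < h * l)%N -> (h.+1 * a j <= h * a j.+1)%N) -> (2 ^ l <= a (h * l))%N.
Proof.
move=> h0 a0 grow_a.
have step n : (n <= h * l)%N -> (h.+1 ^ n <= h ^ n * a n)%N.
  elim: n => [|n IH] ln; first by rewrite !expn0 mul1n.
  rewrite !expnS -mulnA mulnCA; apply: leq_trans (leq_mul (leqnn (h ^ n)) (grow_a n ln)).
  by rewrite mulnCA leq_mul2l IH ?orbT // ltnW.
have := step _ (leqnn _); rewrite !expnM => H.
(* Bernoulli's inequality with [n = h]: growing [h] times by the factor [1 + 1/h] at least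
   doubles. *)
have double : (2 * h ^ h <= h.+1 ^ h)%N.
  by have := bernoulli_nat h h; rewrite addnn -mul2n mulnCA mulnA -(leq_pmul2l h0);
    rewrite mulnA [in leqLHS](mulnC h) => ?; nia.
rewrite -(leq_pmul2l (_ : 0 < (h ^ h) ^ l)%N) ?expn_gt0 ?h0 //.
apply: leq_trans H; rewrite -expnMn mulnC.
by case: l {grow_a step} => [|l]; rewrite ?expn0 // leq_exp2r.
Qed.

Section Sparse.
Variables X I : finType.
Implicit Types (T : I -> {set X}) (J : {set I}) (K W : {set X}).

Lemma no_short_dependencyS T J1 J2 K n : J1 \subset J2 ->
  no_short_dependency T J2 K n -> no_short_dependency T J1 K n.
Proof. by move=> sJ nsd q sq; apply: nsd; apply: supportedS sq. Qed.

Lemma cost1 n : cost 1 n = n.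
Proof. by elim: n => //= n ->; rewrite mul1n. Qed.

(* Balls of radius at most [h * l] around a vertex are trees, and one of them
   has a boundary smaller than a [1/h] fraction of it; removing it and
   iterating exhausts the graph. *)
Lemma sparse_graph T h l (W : {set X}) J : (0 < h)%N -> (#|X| < 2 ^ l)%N ->
  (forall i, i \in J -> T i \subset W /\ #|T i| = 2%N) ->
  no_short_dependency T J set0 (2 * (h * l) + 3) ->
  (h * #|J| <= h.+1 * #|W|)%N.
Proof.
move=> h0 lX; have [n] := ubnP #|W|; elim: n W J => // n IH W J ltWn TJ nsd.
have [->|[i0 Ji0]] := set_0Vmem J; first by rewrite cards0 muln0.
have [sT0 cT0] := TJ _ Ji0.
have [v Tv] : exists v, v \in T i0 by apply/set0Pn; rewrite -card_gt0 cT0.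
have Wv : v \in W by apply: (subsetP sT0).
pose B := level T J [set v].
have BW j : B j \subset W.
  elim: j => [|j IHj]; first by rewrite sub1set.
  rewrite /B /level /= /grow subUset IHj; apply/subsetP => x; rewrite inE.
  by case/exists_inP => i /TJ[/subsetP sTi _] /andP[/sTi].
have T_le i : i \in J -> (#|T i| <= 2)%N by move=> /TJ[_ ->].
(* The boundary of a set of edges has an even number of vertices, so if it vanishes outside [v] it
   vanishes at [v] too. *)
have nsdv : no_short_dependency T J [set v] (2 * (h * l) + 3).
  move=> q sq bq; apply: nsd => // x _.
  have [-> {x}|xv] := eqVneq x v; last by apply: bq; rewrite inE.
  have: \sum_x bdry T q x = 0.
    rewrite exchange_big big1 //= => i _; rewrite -mulr_sumr.
    have [Ji|nJi] := boolP (i \in J); last by rewrite sq // mul0r.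
    rewrite (eq_bigr (fun x => if x \in T i then 1 else 0)); last by move=> x _; case: ifP.
    rewrite -big_mkcond /= sumr_const; have [_ ->] := TJ i Ji.
    by rewrite (_ : 1 *+ 2 = 0) ?mulr0 //; apply/val_inj.
  by rewrite (bigD1 v) //= big1 ?addr0 // => x xv; apply: bq; rewrite inE.
(* Otherwise the ball would grow by a factor above [1 + 1/h] at each of [h * l] radii and reach
   [2 ^ l] vertices, more than [X] has. *)
have [j lt_j Bj] : exists2 j, (j < h * l)%N & (h * #|B j.+1| <= h.+1 * #|B j|)%N.
  pose ok (j : 'I_(h * l)) := (h * #|B j.+1| <= h.+1 * #|B j|)%N.
  have [j okj|no] := pickP ok; first by exists j.
  suff : (2 ^ l <= #|B (h * l)%N|)%N.
    by move=> H; have := leq_trans lX (leq_trans H (max_card _)); rewrite ltnn.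
  apply: (@geometric_growth h l (fun j => #|B j|)) => // [|j lt_j]; first by rewrite cards1.
  by apply: ltnW; rewrite ltnNge; have := no (Ordinal lt_j); rewrite /ok /= => ->.
pose J' := [set i in J | [disjoint T i & B j]].
have leJ' : (h * #|J'| <= h.+1 * #|W :\: B j|)%N.
  apply: IH.
  - rewrite -ltnS; apply: leq_trans ltWn; rewrite ltnS; apply: proper_card.
    apply/properP; split; first exact: subsetDl.
    exists v => //; rewrite inE negb_and negbK.
    by rewrite (subsetP (level0_sub T J [set v] j)) ?inE.
  - move=> i; rewrite inE => /andP[Ji dj]; have [sT cT] := TJ i Ji; split=> //.
    by rewrite subsetD sT.
  - by apply: no_short_dependencyS nsd; apply/subsetP => i; rewrite inE => /andP[].
(* An edge that meets the ball of radius [j] lies inside the ball of radius [j.+1], where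
   [inner_rows] counts it; the weight needed is [2 * j.+1], at most [2 * (h * l)]. *)
have leJ : (#|J :\: J'| <= #|B j.+1|)%N.
  apply: leq_trans (leq_trans (@inner_rows _ _ T J [set v] 1 isT T_le j.+1 _ nsdv _) _).
  - apply/subset_leq_card/subsetP => i; rewrite !inE => /andP[nJ' Ji]; rewrite Ji /=.
    move: nJ'; rewrite Ji /= => /pred0Pn[x /andP[/= Tx Bx]].
    have [_ cT] := TJ i Ji.
    have cTx : #|T i :\ x| = 1%N by move: (cardsD1 x (T i)); rewrite Tx cT => -[].
    have /cards1P[y Ty] : #|T i :\ x| == 1%N by rewrite cTx.
    rewrite -(setD1K Tx) Ty subUset !sub1set (subsetP (level_sub _ _ _ _)) //=.
    rewrite /B /level /= inE [X in _ || X]inE; apply/orP; right; apply/exists_inP; exists i => //.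
    have : y \in T i :\ x by rewrite Ty inE.
    rewrite inE => /andP[yx ->] /=; apply/subsetP => z; rewrite in_setD1 => /andP[zy Tz].
    have [-> //|zx] := eqVneq z x.
    by have : z \in T i :\ x; [rewrite !inE zx | rewrite Ty in_set1 (negPf zy)].
  - by rewrite cost1; lia.
  - exact/subset_leq_card/subsetDl.
have cJ : (#|J| = #|J'| + #|J :\: J'|)%N.
  rewrite -(cardsID J' J); congr (_ + _)%N; apply: eq_card => i.
  by rewrite !inE; case: (i \in J).
have cW : (#|W| = #|B j| + #|W :\: B j|)%N.
  by rewrite -(cardsID (B j) W) (setIidPr (BW j)).
rewrite cJ cW !mulnDr addnC leq_add //.
by apply: leq_trans Bj; rewrite leq_mul2l leJ orbT.
Qed.

End Sparse.

(** * Degree counting for relations between three vertices *)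

Section Triples.
Variables X I : finType.
Variables (T : I -> {set X}) (K0 : {set X}).

Definition degree x := #|[set i | x \in T i]|.

Lemma sum_degree (K : {set X}) :
  (\sum_(x in K) degree x = \sum_i #|T i :&: K|)%N.
Proof.
transitivity (\sum_(x in K) \sum_i (x \in T i))%N.
  by apply: eq_bigr => x _; rewrite /degree -sum1dep_card big_mkcond; apply: eq_bigr => i _; case: ifP.
rewrite exchange_big; apply: eq_bigr => i _.
rewrite -sum1_card [RHS](eq_bigl (fun x => (x \in K) && (x \in T i))); last first.
  by move=> x; rewrite inE andbC.
by rewrite big_mkcondr; apply: eq_bigr => x _; case: ifP.
Qed.

Lemma cost2 n : ((cost 2 n).+1 = 2 ^ n)%N.
Proof. by elim: n => //= n IH; rewrite expnS -IH; lia. Qed.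

(** Pigeonhole: the first [h] layers are disjoint subsets of [X]. *)
Lemma thin_level h (J : {set I}) : (0 < h)%N -> exists2 n, (n < h)%N &
  (h * #|level T J K0 n.+1 :\: level T J K0 n| <= #|X|)%N.
Proof.
move=> h0; pose ok (n : 'I_h) := (h * #|level T J K0 n.+1 :\: level T J K0 n| <= #|X|)%N.
have [n okn|no] := pickP ok; first by exists n.
have step k : (k <= h)%N -> (k * #|X|.+1 <= h * #|level T J K0 k|)%N.
  elim: k => [|k IH] ltkh; first by rewrite mul0n.
  have := no (Ordinal ltkh); rewrite /ok /= => /negbT; rewrite -ltnNge => ltX.
  have -> : (#|level T J K0 k.+1| = #|level T J K0 k| + #|level T J K0 k.+1 :\: level T J K0 k|)%N.
    by rewrite -(cardsID (level T J K0 k)) (setIidPr (level_sub _ _ _ _)).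
  by rewrite mulSn addnC mulnDr leq_add // IH // ltnW.
have := step h (leqnn _); rewrite leq_pmul2l // => le.
by have := leq_trans le (max_card _); rewrite ltnn.
Qed.

(** Close [K0] up to a thin layer, giving [K], and sort the triples by their number of elements in
    [K]. Those with three are at most [#|K :\: K0|], those with two are at most the size of the next
    layer, and those with one are edges of a sparse graph on the complement. This bounds the total
    degree on [K]; the degree hypothesis on [K :\: K0] is then subtracted. *)
Lemma known_degree_bound h l delta :
  (forall i, #|T i| = 3%N) -> (0 < h)%N -> (#|X| < 2 ^ l)%N ->
  no_short_dependency T setT K0 ((2 * (h * l) + 3) * (3 * 2 ^ h)) ->
  (forall Z : {set X}, [disjoint Z & K0] ->
     (2 * #|Z| <= \sum_(x in Z) degree x + delta)%N) ->
  (h * \sum_(x in K0) degree x <= h * delta + 2 * #|X| + h.+1 * #|~: K0|)%N.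
Proof.
move=> T3 h0 lX nsd degZ.
have [n ltnh thin] := thin_level setT h0.
set K := level T setT K0 n in thin *; set K' := level T setT K0 n.+1 in thin *.
have T_le i : i \in setT -> (#|T i| <= 3)%N by rewrite T3.
have costn : ((3 * cost 2 n).+1 <= 3 * 2 ^ h)%N.
  have : (2 ^ n <= 2 ^ h)%N by rewrite leq_exp2l // ltnW.
  by rewrite -cost2; lia.
have M_gt0 : (3 * 2 ^ h <= (2 * (h * l) + 3) * (3 * 2 ^ h))%N.
  by rewrite leq_pmull // addnC.
have inner : (#|[set i | T i \subset K]| <= #|K :\: K0|)%N.
  apply: leq_trans (@inner_rows _ _ T setT K0 2 isT T_le n _ nsd _).
    by apply: eq_leq; apply: eq_card => i; rewrite !inE.
  exact: leq_trans M_gt0.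
have outer := @outer_rows _ _ T setT K0 2 isT T_le n _ (2 * (h * l) + 3) nsd.
have {}outer := outer (leq_mul (leqnn _) costn).
pose A j := [set i | #|T i :&: K| == j].
have AT i j : i \in A j -> #|T i :\: K| = (3 - j)%N.
  by rewrite inE => /eqP cA; have := cardsID K (T i); rewrite cA T3; lia.
have A_outer i j : (j < 3)%N -> i \in A j -> i \in [set i in setT | ~~ (T i \subset K)].
  move=> j3 /AT cA; rewrite inE in_setT /=; apply/negP; rewrite -setD_eq0 => /eqP T0.
  by move: cA; rewrite T0 cards0; lia.
have cA3 : (#|A 3| <= #|K :\: K0|)%N.
  apply: leq_trans inner; apply/subset_leq_card/subsetP => i /AT; rewrite !inE -setD_eq0 subnn => /eqP.
  by rewrite cards_eq0.
(* [f] sends such a triple to its only unknown element. Two triples with the same value would form a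
   dependency of weight 2 modulo [K]. *)
have cA2 : (#|A 2| <= #|K' :\: K|)%N.
  have /fin_all_exists[f fP] : forall i, exists x, i \in A 2 -> T i :\: K = [set x].
    move=> i; have [/AT/eqP/cards1P[x ->]|_] := boolP (i \in A 2); first by exists x.
    have /set0Pn[x _] : T i != set0 by rewrite -card_gt0 T3.
    by exists x.
  rewrite -(card_in_imset (f := f)); last first.
    move=> i j Ai Aj eqf; apply/eqP; apply: contraT => ij.
    have q0 : unit_at i + unit_at j = 0.
      apply: outer.
      - by apply: supportedD; apply: supported_unit; apply: (@A_outer _ 2).
      - move=> x Kx; rewrite bdryD !bdry_unit.
        have Tx k : k \in A 2 -> (x \in T k) = (x == f k).
          by move=> /fP/setP/(_ x); rewrite !inE Kx.
        by rewrite !Tx // eqf; case: eqP => _; [apply/val_inj|rewrite addr0].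
      - by apply: leq_trans (wtD _ _) _; rewrite !wt_unit; lia.
    have := congr1 (fun g : {ffun I -> 'F_2} => g i) q0.
    by rewrite !ffunE eqxx (negPf ij) addr0.
  apply/subset_leq_card/subsetP => _ /imsetP[i Ai ->].
  have /setP/(_ (f i)) := fP i Ai; rewrite !inE eqxx => /andP[nK Ti].
  rewrite nK /=; apply/orP; right; apply/exists_inP; exists i; rewrite ?inE // Ti /=.
  apply/subsetP => x; rewrite in_setD1 => /andP[xf Tx]; apply: contraT => nKx.
  by have /setP/(_ x) := fP i Ai; rewrite !inE Tx nKx (negPf xf).
have cA1 : (h * #|A 1| <= h.+1 * #|~: K|)%N.
  apply: (@sparse_graph X I (fun i => T i :\: K) h l) => //.
    move=> i /AT ->; split=> //; by rewrite setDE subsetIr.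
  move=> q sq bq wq; apply: outer => // [|x Kx].
    by apply: supportedS sq; apply/subsetP => i; apply: A_outer.
  have := bq x; rewrite inE => /(_ isT) <-.
  by apply: eq_bigr => i _; rewrite inE Kx.
have sumK : (\sum_(x in K) degree x <= 3 * #|A 3| + 2 * #|A 2| + #|A 1|)%N.
  rewrite sum_degree.
  have count j c : (c * #|A j| = \sum_i (if i \in A j then c else 0))%N.
    by rewrite -big_mkcond sum_nat_const mulnC.
  rewrite (count 3) (count 2) -[#|A 1|]mul1n (count 1) -!big_split /=.
  apply: leq_sum => i _; rewrite !inE.
  have : (#|T i :&: K| <= 3)%N by rewrite -(T3 i) subset_leq_card // subsetIl.
  by case: #|_| => [|[|[|[|]]]].
have K0K : K0 \subset K := level0_sub _ _ _ _.
have sumK0 : (\sum_(x in K) degree x = \sum_(x in K0) degree x + \sum_(x in K :\: K0) degree x)%N.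
  by rewrite (big_setID K0) /= (setIidPr K0K).
have cK0 : (#|~: K0| = #|K :\: K0| + #|~: K|)%N.
  rewrite -(cardsID K) setIC -setDE; congr (_ + _)%N; apply: eq_card => x.
  by rewrite !inE; have := subsetP K0K x; case: (x \in K0) => //= H; rewrite ?andbT // H.
have := degZ (K :\: K0) _;
  rewrite -setI_eq0 setDE -setIA (setIC (~: _)) setICr setI0 eqxx -setDE => /(_ isT).
move: sumK; rewrite sumK0 cK0.
set D0 := (\sum_(x in K0) _)%N; set D1 := (\sum_(x in _) _)%N; move: cA3 cA2 cA1 thin.
by nia.
Qed.

End Triples.

(** * Straight-line programs with few gates *)

Lemma F2_add_self (V : lmodType 'F_2) (x : V) : x + x = 0.
Proof. by rewrite -mulr2n -scaler_nat (_ : 2%:R = 0 :> 'F_2) ?scale0r //; apply/val_inj. Qed.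

Lemma F2_addK (x : 'F_2) : x + x = 0.
Proof. exact: (@F2_add_self ('F_2)^o). Qed.

(** [D] stands for the total degree of the known vertices and [u] for the number of unknown ones. *)
Lemma program_bound_arith h m N G D u : (N <= m)%N -> (u + 2 * N = m + G)%N ->
  (3 * N <= D + (m - N))%N ->
  (h * D <= h * (3 * (m - N)) + 2 * (m + G) + h.+1 * u)%N ->
  (4 * h * m <= 9 * h * (m - N) + h * G + 3 * (m + G))%N.
Proof.
move=> /subnKC; set r := (m - N)%N => <- eu leD lehD.
have E1 : (h * (3 * N) <= h * (D + r))%N by rewrite leq_mul2l leD orbT.
have E2 : (h * (u + 2 * N) = h * (N + r + G))%N by rewrite eu.
lia.
Qed.

Section Program.
Variables (m G : nat).
Local Notation vertex := 'I_(m + G).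
Variables (v : vertex -> 'rV['F_2]_m) (t1 t2 : 'I_G -> vertex).

Definition gate_vertex (g : 'I_G) : vertex := rshift m g.
Definition inp (j : 'I_m) : vertex := lshift G j.
Definition tails g : {set vertex} := [set t1 g; t2 g].

Hypothesis v_inp : forall j, v (inp j) = delta_mx 0 j.
Hypothesis v_head : forall g, v (gate_vertex g) = v (t1 g) + v (t2 g).
Hypothesis t1_lt : forall g, (t1 g < gate_vertex g)%N.
Hypothesis t2_lt : forall g, (t2 g < gate_vertex g)%N.
Hypothesis t12 : forall g, t1 g != t2 g.

Lemma tail_lt g t : t \in tails g -> (t < gate_vertex g)%N.
Proof. by rewrite !inE => /orP[] /eqP ->. Qed.

Definition users x : {set 'I_G} := [set g | x \in tails g].

Lemma mem_users g x : (g \in users x) = (x \in tails g).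
Proof. by rewrite in_set. Qed.

Definition coef c x := v x 0 c.

Lemma coef_inp c j : coef c (inp j) = (c == j)%:R.
Proof. by rewrite /coef v_inp mxE eqxx. Qed.

Lemma coef_inp_neq0 c j : coef c (inp j) != 0 -> j = c.
Proof. by rewrite coef_inp; have [->|_] := eqVneq c j; rewrite // eqxx. Qed.

Lemma coef_head c g : coef c (gate_vertex g) = coef c (t1 g) + coef c (t2 g).
Proof. by rewrite /coef v_head mxE. Qed.

Lemma coef_tail c g : coef c (gate_vertex g) != 0 -> exists2 t, t \in tails g & coef c t != 0.
Proof.
rewrite coef_head; have [->|n1] := eqVneq (coef c (t1 g)) 0.
  by rewrite add0r; exists (t2 g); rewrite // !inE eqxx orbT.
by exists (t1 g); rewrite // !inE eqxx.
Qed.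

Lemma vertexP x : (exists j, x = inp j) \/ (exists g, x = gate_vertex g).
Proof. by case: (split_ordP x) => [j ->|g ->]; [left; exists j|right; exists g]. Qed.

Lemma head_ge g : (m <= gate_vertex g)%N.
Proof. exact: leq_addr. Qed.

Lemma inp_lt j : (inp j < m)%N.
Proof. exact: (ltn_ord j). Qed.

(** * Chains of singly used vertices *)

Section Bottleneck.
Variable W : {set vertex}.

Definition fan x : nat := (#|users x| + (x \in W))%N.

(** [n] is read as a time: [x] is live if it is still needed once the vertices up to [n] have been
    computed. *)
Definition live (n : nat) x := (x \in W) || [exists g, (n < gate_vertex g)%N && (x \in tails g)].

(* The end of the chain of singly used vertices that starts at the input [c];
   [y] is only the default value of the minimum. *)
Definition bottleneck c y := [arg min_(x < y | (coef c x != 0) && (fan x != 1)%N) (x : nat)].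

Definition starved c y := [/\ fan (inp c) = 1%N, fan y = 0%N, coef c y != 0 &
  exists2 w, w \in W & coef c w != 0].

Section OneColumn.
Variables (c : 'I_m) (y : vertex).
Hypothesis cy : starved c y.
Local Notation vk := (bottleneck c y).

Lemma bottleneckP : [/\ coef c vk != 0, fan vk != 1%N &
  forall x, coef c x != 0 -> fan x != 1%N -> (vk <= x)%N].
Proof.
case: cy => _ fy cy0 _; rewrite /bottleneck; case: arg_minnP => [|x /andP[? ?] min].
  by rewrite cy0 fy.
by split=> // z z1 z2; apply: min; rewrite z1.
Qed.

(** Up to the bottleneck every vertex depending on [c] has fan one, so computing the next such
    vertex spends the only use of the previous one: a single copy of the dependence on [c] is live
    at any time. *)
Lemma live_unique n (x x' : vertex) : (n <= vk)%N -> (x <= n)%N -> (x' <= n)%N ->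
  coef c x != 0 -> coef c x' != 0 -> live n x -> live n x' -> x = x'.
Proof.
have [_ _ min] := bottleneckP.
have inputs (z : vertex) : (z < m)%N -> coef c z != 0 -> z = inp c.
  case: (vertexP z) => [[j ->] _|[g ->]]; last by rewrite ltnNge head_ge.
  by move=> /coef_inp_neq0 ->.
have [ltnm|] := ltnP n m.
  move=> _ lx lx' cx cx' _ _.
  by rewrite (inputs x (leq_ltn_trans lx ltnm) cx) (inputs x' (leq_ltn_trans lx' ltnm) cx').
elim: n x x' => [|n IH] x x' lemn levk lx lx' cx cx' Lx Lx'.
  move: lx lx'; rewrite !leqn0 => /eqP x0 /eqP x0'.
  by apply: val_inj; rewrite /= x0 x0'.
have liveS z : live n.+1 z -> live n z.
  case/orP=> [Wz|/existsP[g /andP[ltg gz]]]; apply/orP; [by left|right].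
  by apply/existsP; exists g; rewrite gz (ltn_trans _ ltg).
have stepn : forall z : vertex, (z <= n)%N -> coef c z != 0 -> live n z ->
    forall z' : vertex, (z' <= n)%N -> coef c z' != 0 -> live n z' -> z = z'.
  move=> z lz cz Lz z' lz' cz' Lz'.
  have [ltnm|lemn'] := ltnP n m.
    by rewrite (inputs z (leq_ltn_trans lz ltnm) cz) (inputs z' (leq_ltn_trans lz' ltnm) cz').
  by apply: IH => //; apply: ltnW.
(* A gate at time [n.+1] depending on [c] has a tail depending on [c], which was the unique live
   vertex at time [n]. Its fan is one and is spent here, so no older vertex depending on [c] remains
   live. *)
have new (z z' : vertex) : z = n.+1 :> nat -> (z' <= n)%N -> coef c z != 0 -> coef c z' != 0 ->
    live n.+1 z' -> False.
  move=> zn lz' cz cz' Lz'.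
  case: (vertexP z) => [[j zj]|[g zg]]; first by have := inp_lt j; rewrite -zj zn ltnNge lemn.
  rewrite zg in cz; have [t gt ct] := coef_tail cz.
  have ltt : (t <= n)%N by have := tail_lt gt; rewrite -zg zn.
  have Lt : live n t.
    by apply/orP; right; apply/existsP; exists g; rewrite gt -zg zn leqnn.
  have ez : z' = t by apply: stepn => //; apply: liveS.
  have ft : fan t = 1%N.
    apply/eqP; apply: contraT => ft; have := min t ct ft.
    by rewrite leqNgt (leq_trans _ levk).
  move: Lz'; rewrite ez => /orP[Wt|/existsP[g' /andP[ltg' gt']]].
    have : (0 < #|users t|)%N by apply/card_gt0P; exists g; rewrite mem_users.
    by move: ft; rewrite /fan Wt addn1 => -[->].
  have : (1 < #|users t|)%N.
    apply/card_gt1P; exists g, g'; rewrite !mem_users; split=> //.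
    by apply/eqP => gg; move: ltg'; rewrite -gg -zg zn ltnn.
  by rewrite ltnNge -[X in (_ <= X)%N]ft leq_addr.
case: (ltngtP x n.+1) lx => // xn _; case: (ltngtP x' n.+1) lx' => // xn' _.
- by apply: stepn => //; apply: liveS.
- by case: (new x' x).
- by case: (new x x').
- by apply: val_inj; rewrite /= xn xn'.
Qed.

(** All dependence on [c] beyond the bottleneck passes through it: just before it the only live
    vertex depending on [c] is one of its tails, whose single use is the bottleneck gate. *)
Lemma before_bottleneck (x : vertex) : (x < vk)%N -> coef c x != 0 ->
  x \notin W /\ forall g, x \in tails g -> (gate_vertex g <= vk)%N.
Proof.
have [cvk fvk min] := bottleneckP; move=> ltx cx.
have fx : fan x = 1%N.
  by apply/eqP; apply: contraT => fx; have := min x cx fx; rewrite leqNgt ltx.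
case: (vertexP vk) => [[j vj]|[g vg]].
  by move: fvk; rewrite vj; move: cvk; rewrite vj => /coef_inp_neq0 ->; case: cy => ->.
have [t gt ct] : exists2 t, t \in tails g & coef c t != 0 by apply: coef_tail; rewrite -vg.
have vk1 : vk = vk.-1.+1 :> nat by rewrite prednK // (leq_trans _ ltx).
have ltt : (t < vk)%N by rewrite vg tail_lt.
have Lt : live vk.-1 t.
  by apply/orP; right; apply/existsP; exists g; rewrite gt -vg [X in (_ < X)%N]vk1 leqnn.
have uniq_live : live vk.-1 x -> x = t.
  move=> Lx; apply: (@live_unique vk.-1) => //; first exact: leq_pred.
    by rewrite -ltnS -vk1.
  by rewrite -ltnS -vk1.
have gx_one : x = t -> g \in users x by move=> ->; rewrite mem_users.
split=> [|g' gx'].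
  apply/negP => Wx; have xt := uniq_live (introT orP (or_introl Wx)).
  have : (0 < #|users x|)%N by apply/card_gt0P; exists g; exact: gx_one.
  by move: fx; rewrite /fan Wx addn1 => -[->].
rewrite leqNgt; apply/negP => ltg'.
have xt : x = t.
  apply: uniq_live; apply/orP; right; apply/existsP; exists g'; rewrite gx' andbT.
  by apply: leq_ltn_trans ltg'; exact: leq_pred.
have : (1 < #|users x|)%N.
  apply/card_gt1P; exists g, g'; rewrite gx_one // mem_users; split=> //.
  by apply/eqP => gg; move: ltg'; rewrite -gg vg ltnn.
by rewrite ltnNge -[X in (_ <= X)%N]fx leq_addr.
Qed.

(** The fan differs from one by definition. It is not zero either: tracing the dependence on [c]
    backwards from a vertex of [W] beyond the bottleneck must lead to a use of it. *)
Lemma bottleneck_fan : (1 < fan vk)%N.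
Proof.
have [cvk fvk min] := bottleneckP.
suff : fan vk != 0%N by move: fvk; lia.
apply/eqP => f0; have [_ _ _ [w Ww cw]] := cy.
have : (vk < w)%N.
  rewrite ltn_neqAle; apply/andP; split.
    by apply/eqP => /val_inj vw; move: f0; rewrite vw /fan Ww; lia.
  by rewrite leqNgt; apply/negP => /before_bottleneck/(_ cw)[]; rewrite Ww.
have [n] := ubnP (w : nat); elim: n w cw {Ww} => // n IH w cw ltwn ltvw.
case: (vertexP w) => [[j wj]|[g wg]].
  move: cw; rewrite wj => /coef_inp_neq0 cj; case: (vertexP vk) => [[i vi]|[g vg]].
    by move: cvk ltvw; rewrite vi wj cj => /coef_inp_neq0 ->; rewrite ltnn.
  by move: ltvw; rewrite vg wj; have := head_ge g; have := inp_lt j; lia.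
have [t gt ct] : exists2 t, t \in tails g & coef c t != 0 by apply: coef_tail; rewrite -wg.
have ltt : (t < w)%N by rewrite wg tail_lt.
case: (ltngtP t vk) => [ltv|ltv|/val_inj tv].
- by have [_ /(_ g gt)] := before_bottleneck ltv ct; rewrite -wg leqNgt ltvw.
- by apply: (IH t) => //; apply: leq_trans ltt _.
- have : (0 < #|users t|)%N by apply/card_gt0P; exists g; rewrite mem_users.
  by move: f0; rewrite tv /fan; lia.
Qed.

Lemma bottleneck_lt : (vk < y)%N.
Proof.
have [_ fy cy0 _] := cy; have [_ _ min] := bottleneckP.
rewrite ltn_neqAle min ?fy // andbT; apply/eqP => /val_inj vy.
by have := bottleneck_fan; rewrite vy fy.
Qed.

Lemma inp_lt_bottleneck : (inp c < vk)%N.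
Proof.
have [cvk fvk _] := bottleneckP.
case: (vertexP vk) => [[j vj]|[g ->]]; last exact: leq_trans (inp_lt c) (head_ge g).
by move: fvk; rewrite vj; move: cvk; rewrite vj => /coef_inp_neq0 ->; case: cy => ->.
Qed.

Lemma inp_before_bottleneck : inp c \notin W /\ forall g, inp c \in tails g -> (gate_vertex g <= vk)%N.
Proof. by apply: before_bottleneck inp_lt_bottleneck _; rewrite coef_inp eqxx. Qed.

End OneColumn.

(** Past a common bottleneck both dependences enter only through that vertex, so the coefficients of
    [c] and [c'] agree from there on, in particular at [y]. *)
Lemma bottleneck_inj c c' y y' : starved c y -> starved c' y' ->
  coef c' y = 0 -> bottleneck c y != bottleneck c' y'.
Proof.
move=> cy cy' cy0; apply/eqP => eqv.
have [cv _ _] := bottleneckP cy; have [cv' _ _] := bottleneckP cy'.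
have agree (x : vertex) : (bottleneck c y <= x)%N -> coef c x = coef c' x.
  have [n] := ubnP (x : nat); elim: n x => // n IH x ltxn.
  rewrite leq_eqVlt => /orP[/eqP/val_inj <-|ltv].
    by rewrite (F2_neq0 cv) [in RHS]eqv (F2_neq0 cv').
  case: (vertexP x) => [[j xj]|[g xg]].
    case: (vertexP (bottleneck c y)) => [[i vi]|[g vg]].
      by have := inp_lt_bottleneck cy; move: cv; rewrite vi => /coef_inp_neq0 ->; rewrite ltnn.
    by move: ltv; rewrite vg xj; have := head_ge g; have := inp_lt j; lia.
  have tail t : t \in tails g -> coef c t = coef c' t.
    move=> gt; have ltt : (t < x)%N by rewrite xg tail_lt.
    have [ltv'|] := ltnP t (bottleneck c y); last first.
      by apply: IH; apply: leq_trans ltt _.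
    have zero d z : starved d z -> bottleneck d z = bottleneck c y -> coef d t = 0.
      move=> dz eqd; apply/eqP; apply: contraT => ct.
      have ltd : (t < bottleneck d z)%N by rewrite eqd.
      have [_ /(_ g gt)] := before_bottleneck dz ltd ct.
      by rewrite eqd -xg leqNgt ltv.
    by rewrite (zero c y) ?(zero c' y').
  by rewrite xg !coef_head !tail // !inE eqxx ?orbT.
have := agree y (ltnW (bottleneck_lt cy)); rewrite cy0 => cyz.
by case: cy => _ _; rewrite cyz eqxx.
Qed.

End Bottleneck.

(** * Formal sums of gate relations *)

Section Formal.
Variable q : {ffun 'I_G -> 'F_2}.

Definition triple g : {set vertex} := gate_vertex g |: tails g.

Lemma mem_triple x g : (x \in triple g) = (x == gate_vertex g) || (x \in tails g).
Proof. exact: in_setU1. Qed.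

Local Notation n := (bdry triple q).

Lemma head_notin_tails g : gate_vertex g \notin tails g.
Proof. by apply/negP => /tail_lt; rewrite ltnn. Qed.

Lemma card_triple g : #|triple g| = 3%N.
Proof. by rewrite cardsU1 head_notin_tails cards2 t12. Qed.

Lemma formal_value c : \sum_x n x * coef c x = 0.
Proof.
under eq_bigr => x _ do rewrite mulr_suml.
rewrite exchange_big big1 //= => g _.
under eq_bigr => x _ do rewrite -mulrA.
rewrite -mulr_sumr (eq_bigr (fun x => if x \in triple g then coef c x else 0)); last first.
  by move=> x _; case: ifP => _; rewrite ?mul1r ?mul0r.
rewrite -big_mkcond /= big_setU1 ?head_notin_tails //= big_setU1 ?inE ?t12 //= big_set1.
by rewrite coef_head F2_addK mulr0.
Qed.

(** The system is triangular: the head of the last selected gate lies in no other selected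
    triple. *)
Lemma formal_neq0 : q != 0 -> exists x, n x != 0.
Proof.
move=> q0; have [g0 qg0] : exists g, q g != 0.
  have [g qg|no] := pickP (fun g => q g != 0); first by exists g.
  by move/eqP: q0; case; apply/ffunP => g; rewrite ffunE; apply/eqP; have := no g => /negbFE.
have [g qg max] := @arg_maxnP _ g0 (fun g => q g != 0) (fun g => g : nat) qg0.
exists (gate_vertex g); rewrite /bdry (bigD1 g) //= setU11 mulr1 big1 ?addr0 // => i ig.
have [->|/max leig] := eqVneq (q i) 0; first by rewrite mul0r.
case: (boolP (gate_vertex g \in triple i)); rewrite ?mulr0 // !inE => /orP[/eqP/rshift_inj gi|].
  by rewrite gi eqxx in ig.
move=> gi; have := @tail_lt i (gate_vertex g); rewrite !inE => /(_ gi) /=.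
by rewrite ltn_add2l ltnNge (leig : (i <= g)%N).
Qed.

Lemma formal_card : (#|[set x | n x != 0%R]| <= 3 * wt q)%N.
Proof.
apply: (@leq_trans #|\bigcup_(g in [set g | q g != 0%R]) triple g|).
  apply/subset_leq_card/subsetP => x; rewrite inE; apply: contraR => nx.
  rewrite /bdry big1 // => g _; have [->|qg] := eqVneq (q g) 0; first by rewrite mul0r.
  case: (boolP (x \in triple g)); rewrite ?mulr0 // => xg.
  by case/negP: nx; apply/bigcupP; exists g => //; rewrite in_set.
rewrite mulnC /wt -sum_nat_const.
elim/big_rec2: _ => [|g k B _ IH]; first by rewrite cards0.
by apply: leq_trans (leq_card_setU _ _) _; rewrite card_triple leq_add2l.
Qed.

End Formal.

(** * Known and unknown vertices of a program for the matrix *)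

Section Assembly.
Variables (o : 'I_m -> vertex) (A : 'M['F_2]_m) (N s : nat) (yr bc : 'I_N -> 'I_m).
Hypothesis o_inj : injective o.
Hypothesis v_out : forall i, v (o i) = row i A.
Hypothesis used : forall x, x \in codom o \/ exists g, x \in tails g.
Hypothesis yr_inj : injective yr.
Hypothesis bc_inj : injective bc.
Hypothesis A_diag : forall k j, A (yr k) (bc j) = (k == j)%:R.
Hypothesis s_gt0 : (0 < s)%N.
Hypothesis A_rows : forall J : {set 'I_N}, J != set0 -> (#|J| <= s)%N ->
  exists2 c, c \notin codom bc & \sum_(k in J) A (yr k) c != 0.
Hypothesis A_col : forall k, exists2 i, i \notin codom yr & A i (bc k) != 0.

Definition other_outputs := [set o i | i in [set i | i \notin codom yr]].
Definition bv k := inp (bc k).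
Definition yv k := o (yr k).

(* For a bad [k], [cmap] identifies [bv k] with [yv k], so that only their sum
   counts as known; the end [zv k] of the chain starting at [bv k] is known
   instead.  Such a [bv k] stays in [known] because it meets no merged triple. *)
Definition bad k := (fan other_outputs (bv k) == 1%N) && (fan other_outputs (yv k) == 0%N).
Definition zv k := if bad k then bottleneck other_outputs (bc k) (yv k) else yv k.
Definition cmap x := if [pick k | bad k && (x == bv k)] is Some k then yv k else x.
Definition merged_triple g := cmap @: triple g.
Definition known := [set bv k | k : 'I_N] :|: [set zv k | k : 'I_N].

Lemma coef_out c i : coef c (o i) = A i c.
Proof. by rewrite /coef v_out mxE. Qed.

Lemma coef_y k j : coef (bc j) (yv k) = (k == j)%:R.
Proof. by rewrite coef_out A_diag. Qed.

Lemma coef_y1 k : coef (bc k) (yv k) != 0.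
Proof. by rewrite coef_y eqxx. Qed.

Lemma yv_notin_other_outputs k : yv k \notin other_outputs.
Proof. by apply/imsetP => -[i]; rewrite inE => ni /o_inj yi; rewrite -yi codom_f in ni. Qed.

Lemma bv_inj : injective bv.
Proof. by move=> k j /lshift_inj/bc_inj. Qed.

Lemma yv_inj : injective yv.
Proof. by move=> k j /o_inj/yr_inj. Qed.

Lemma bad_starved k : bad k -> starved other_outputs (bc k) (yv k).
Proof.
case/andP => /eqP f1 /eqP f0; split=> //; first exact: coef_y1.
have [i ni Ai] := A_col k; exists (o i); last by rewrite coef_out.
by apply/imsetP; exists i; rewrite ?inE.
Qed.

Lemma inp_neq_head j g : inp j != gate_vertex g.
Proof. by apply/eqP => jg; have := inp_lt j; rewrite jg ltnNge head_ge. Qed.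

Lemma yv_head k : exists g, yv k = gate_vertex g.
Proof.
case: (vertexP (yv k)) => [[j yj]|//].
have [||c cb] := @A_rows [set k]; rewrite ?cards1 //; first by apply/set0Pn; exists k; rewrite inE.
rewrite big_set1 -coef_out -/(yv k) yj => /coef_inp_neq0 jc.
have := coef_y1 k; rewrite yj => /coef_inp_neq0 jb.
by move: cb; rewrite -jc jb codom_f.
Qed.

Lemma zv_head k : exists g, zv k = gate_vertex g.
Proof.
rewrite /zv; case: ifP => [/bad_starved st|_]; last exact: yv_head.
case: (vertexP (bottleneck other_outputs (bc k) (yv k))) => [[j zj]|//].
have [cz _ _] := bottleneckP st; have := inp_lt_bottleneck st.
by move: cz; rewrite zj => /coef_inp_neq0 ->; rewrite ltnn.
Qed.

Lemma yv_neq_bv k j : yv k != bv j.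
Proof. by have [g ->] := yv_head k; rewrite eq_sym inp_neq_head. Qed.

Lemma zv_neq_bv k j : zv k != bv j.
Proof. by have [g ->] := zv_head k; rewrite eq_sym inp_neq_head. Qed.

Lemma bad_zv k : bad k -> [/\ coef (bc k) (zv k) != 0, (1 < fan other_outputs (zv k))%N,
  (zv k < yv k)%N & forall x, coef (bc k) x != 0 -> fan other_outputs x != 1%N -> (zv k <= x)%N].
Proof.
move=> bk; rewrite /zv bk; have st := bad_starved bk; have [? _ ?] := bottleneckP st.
by split=> //; [exact: bottleneck_fan|exact: bottleneck_lt].
Qed.

Lemma zv_neq_yv k j : bad k -> zv k != yv j.
Proof.
move=> bk; have [cz _ ltz _] := bad_zv bk; apply/eqP => zy.
have jk : j = k by move: cz; rewrite zy coef_y; have [//|_] := eqVneq j k; rewrite eqxx.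
by rewrite zy jk ltnn in ltz.
Qed.

Lemma zv_inj : injective zv.
Proof.
move=> k j; have [bk|gk] := boolP (bad k); have [bj|gj] := boolP (bad j).
- rewrite /zv bk bj => zz; apply/eqP; apply: contraT => kj.
  have := bottleneck_inj (bad_starved bk) (bad_starved bj); rewrite coef_y (negPf kj).
  by rewrite zz eqxx => /(_ erefl).
- by move/eqP; rewrite [in zv j]/zv (negPf gj) (negPf (zv_neq_yv _ bk)).
- by move/esym/eqP; rewrite [in zv k]/zv (negPf gk) (negPf (zv_neq_yv _ bj)).
- by rewrite /zv (negPf gk) (negPf gj) => /yv_inj.
Qed.

Lemma cmap_bv k : bad k -> cmap (bv k) = yv k.
Proof.
move=> bk; rewrite /cmap; case: pickP => [j /andP[_ /eqP/bv_inj ->] //|/(_ k)].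
by rewrite bk eqxx.
Qed.

Lemma cmap_id x : (forall k, bad k -> x != bv k) -> cmap x = x.
Proof.
move=> nb; rewrite /cmap; case: pickP => // j /andP[/nb /negPf ->] //.
Qed.

Lemma cmap_cases x : (exists k, [/\ bad k, x = bv k & cmap x = yv k]) \/
  ((forall k, bad k -> x != bv k) /\ cmap x = x).
Proof.
have [k /andP[bk /eqP xk]|no] := pickP (fun k => bad k && (x == bv k)).
  by left; exists k; split=> //; rewrite xk cmap_bv.
have nb k : bad k -> x != bv k by move=> bk; have := no k; rewrite bk /= => ->.
by right; split=> //; apply: cmap_id.
Qed.

Lemma bad_yv_tail k g : bad k -> yv k \notin tails g.
Proof.
case/andP=> _ /eqP f0; apply/negP => gy.
have : (0 < #|users (yv k)|)%N by apply/card_gt0P; exists g; rewrite mem_users.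
by move: f0; rewrite /fan; lia.
Qed.

Lemma bv_notin_head k g : (bv k \in triple g) = (bv k \in tails g).
Proof. by rewrite mem_triple (negPf (inp_neq_head _ _)). Qed.

Lemma bad_not_both k g : bad k -> ~~ ((bv k \in triple g) && (yv k \in triple g)).
Proof.
move=> bk; apply/negP; rewrite bv_notin_head mem_triple (negPf (bad_yv_tail _ bk)) orbF.
case/andP => gb /eqP yg; have st := bad_starved bk.
have [_ /(_ g gb)] := inp_before_bottleneck st; rewrite -yg leqNgt.
by rewrite bottleneck_lt.
Qed.

Lemma cmap_inj g : {in triple g &, injective cmap}.
Proof.
move=> x x' gx gx'.
case: (cmap_cases x) => [[k [bk xk ->]]|[nb ->]]; case: (cmap_cases x') => [[k' [bk' xk' ->]]|[nb' ->]] //.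
- by move=> /yv_inj kk; rewrite xk xk' kk.
- by move=> yx; have := bad_not_both g bk; rewrite -xk gx yx gx'.
- by move=> xy; have := bad_not_both g bk'; rewrite -xk' gx' -xy gx.
Qed.

Lemma card_merged_triple g : #|merged_triple g| = 3%N.
Proof. by rewrite card_in_imset ?card_triple //; apply: cmap_inj. Qed.

Lemma mem_merged_triple_yv k g : bad k ->
  (yv k \in merged_triple g) = (bv k \in triple g) || (yv k \in triple g).
Proof.
move=> bk; apply/imsetP/orP => [[x gx]|].
  case: (cmap_cases x) => [[j [bj xj ->]]|[_ ->] ->]; last by right.
  by move=> /yv_inj ->; left; rewrite -xj.
case=> [gb|gy]; first by exists (bv k); rewrite ?cmap_bv.
by exists (yv k); rewrite // cmap_id // => j _; apply: yv_neq_bv.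
Qed.

Lemma mem_merged_triple x g : (forall k, bad k -> x != bv k /\ x != yv k) ->
  (x \in merged_triple g) = (x \in triple g).
Proof.
move=> nx; apply/imsetP/idP => [[x' gx']|gx].
  case: (cmap_cases x') => [[j [bj xj ->]] xy|[_ ->] -> //].
  by have [_] := nx j bj; rewrite xy eqxx.
by exists x => //; rewrite cmap_id // => k /nx[].
Qed.

(** The two triples are the gate computing [yv k] and the single gate using [bv k]. *)
Lemma degree_yv k : bad k -> degree merged_triple (yv k) = 2%N.
Proof.
move=> bk; have [g yg] := yv_head k; have st := bad_starved bk.
have [nW _] := inp_before_bottleneck st.
have u1 : #|users (bv k)| = 1%N by case/andP: bk => /eqP; rewrite /fan (negPf nW) addn0.
rewrite /degree; have -> : [set i | yv k \in merged_triple i] = g |: users (bv k).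
  apply/setP => i; rewrite in_setU1 in_set mem_users mem_merged_triple_yv //.
  rewrite bv_notin_head orbC mem_triple (negPf (bad_yv_tail _ bk)) orbF.
  by rewrite yg /gate_vertex (inj_eq (@rshift_inj _ _)) eq_sym.
rewrite cardsU1 u1 mem_users.
by have := bad_not_both g bk; rewrite bv_notin_head yg setU11 andbT => ->.
Qed.

Lemma degree_inp j : (forall k, bad k -> inp j != bv k) -> degree merged_triple (inp j) = #|users (inp j)|.
Proof.
move=> nb; apply: eq_card => g; rewrite in_set mem_users mem_merged_triple; last first.
  by move=> k bk; split; [exact: nb|have [i ->] := yv_head k; apply: inp_neq_head].
by rewrite mem_triple (negPf (inp_neq_head _ _)).
Qed.

Lemma degree_head g : (forall k, bad k -> gate_vertex g != yv k) ->
  degree merged_triple (gate_vertex g) = (#|users (gate_vertex g)|).+1.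
Proof.
move=> ny; rewrite /degree.
have -> : [set i | gate_vertex g \in merged_triple i] = g |: users (gate_vertex g).
  apply/setP => i; rewrite in_setU1 in_set mem_merged_triple; last first.
    by move=> k bk; split; [rewrite eq_sym inp_neq_head|exact: ny].
  by rewrite mem_triple mem_users /gate_vertex (inj_eq (@rshift_inj _ _)) eq_sym.
by rewrite cardsU1 mem_users head_notin_tails.
Qed.

Lemma in_known x : (x \in known) = (x \in [set bv k | k : 'I_N]) || (x \in [set zv k | k : 'I_N]).
Proof. exact: in_setU. Qed.

Lemma yv_notin_known k : bad k -> yv k \notin known.
Proof.
move=> bk; rewrite in_known; apply/negP => /orP[] /imsetP[j _].
  by move/eqP; rewrite (negPf (yv_neq_bv _ _)).
have [bj|gj] := boolP (bad j).
  by move/esym/eqP; rewrite (negPf (zv_neq_yv _ bj)).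
by rewrite /zv (negPf gj) => /yv_inj kj; rewrite -kj bk in gj.
Qed.

(** Undoes the merging: a relation between known vertices is a formal relation of the original
    program in which [bv k] and [yv k] have equal coefficients for bad [k], because their merged
    vertex is unknown. *)
Lemma relation_support q : (forall x, x \notin known -> bdry merged_triple q x = 0) ->
  (forall k, bad k -> bdry triple q (yv k) = bdry triple q (bv k)) /\
  (forall x, bdry triple q x != 0 ->
     [\/ exists k, x = bv k, exists k, x = yv k | exists2 k, bad k & x = zv k]).
Proof.
move=> bq; have eq_bad k : bad k -> bdry triple q (yv k) = bdry triple q (bv k).
  move=> bk; have := bq _ (yv_notin_known bk); rewrite /bdry.
  rewrite (eq_bigr (fun g => q g * (bv k \in triple g)%:R + q g * (yv k \in triple g)%:R)); last first.
    move=> g _; rewrite mem_merged_triple_yv // -mulrDr; congr (_ * _).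
    have := bad_not_both g bk.
    by case: (bv k \in _); case: (yv k \in _) => //= _; rewrite ?addr0 ?add0r.
  rewrite big_split /=; set a := \sum_i _; set b := \sum_i _ => ab.
  by rewrite -[b]add0r -(F2_addK a) -addrA ab addr0.
split=> // x nx.
have [|nK] := boolP (x \in known).
  rewrite in_known => /orP[] /imsetP[k _ ->]; first by constructor 1; exists k.
  have [bk|gk] := boolP (bad k); first by constructor 3; exists k.
  by constructor 2; exists k; rewrite /zv (negPf gk).
have [/existsP[k /andP[_ /eqP ->]]|no] := boolP [exists k, bad k && (x == yv k)].
  by constructor 2; exists k.
suff eqn : bdry triple q x = bdry merged_triple q x by rewrite eqn bq ?eqxx in nx.
apply: eq_bigr => g _; rewrite mem_merged_triple // => k bk; split.
  apply: contraNneq nK => ->; rewrite in_known; apply/orP; left; exact: imset_f.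
by apply: contraNneq no => xy; apply/existsP; exists k; rewrite bk xy eqxx.
Qed.

Lemma known_independent M : (3 * M <= s)%N -> no_short_dependency merged_triple setT known M.
Proof.
move=> Ms q _ bq wq; apply/eqP; apply: contraT => q0.
have [eq_bad suppn] := relation_support bq.
set n := bdry triple q in eq_bad suppn.
have rel c : \sum_x n x * coef c x = 0 := formal_value q c.
have cardn : (#|[set x | n x != 0%R]| <= s)%N.
  by apply: leq_trans (leq_trans (formal_card q) _) Ms; rewrite leq_mul2l wq orbT.
have no_bottleneck k0 : bad k0 -> n (zv k0) = 0.
  move=> bk0; apply/eqP; apply: contraT => nk0.
  pose P k := bad k && (n (zv k) != 0).
  have Pk0 : P k0 by rewrite /P bk0 nk0.
  (* Take the last chain end involved and read column [bc k]. The terms of [bv k] and [yv k] cancel;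
     another chain end depending on [bc k] would come no earlier than [zv k] by minimality of the
     bottleneck, and no later by the choice of [k]. *)
  have [k /andP[bk nk] max] := @arg_maxnP _ k0 P (fun k => zv k : nat) Pk0.
  have [cz fz ltz min] := bad_zv bk.
  have := rel (bc k).
  rewrite (bigD1 (zv k)) //= (bigD1 (yv k)) /=; last by rewrite eq_sym zv_neq_yv.
  rewrite (bigD1 (bv k)) /=; last by rewrite eq_sym zv_neq_bv eq_sym yv_neq_bv.
  rewrite big1 => [|x /andP[/andP[xz xy] xb]].
    rewrite coef_inp coef_y !eqxx !mulr1 addr0 eq_bad // F2_addK addr0 => /eqP.
    by rewrite mulf_eq0 (negPf nk) (negPf cz).
  have [->|nx] := eqVneq (n x) 0; first by rewrite mul0r.
  suff -> : coef (bc k) x = 0 by rewrite mulr0.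
  case: (suppn x nx) => [[j xj]|[j xj]|[j bj xj]].
  - apply/eqP; apply: contraT; rewrite xj => /coef_inp_neq0 /bc_inj jk.
    by rewrite xj jk eqxx in xb.
  - rewrite xj coef_y; have [jk|//] := eqVneq j k.
    by rewrite xj jk eqxx in xy.
  - apply/eqP; apply: contraT => cx; have [_ fj _ _] := bad_zv bj.
    have fx : fan other_outputs x != 1%N by rewrite xj; apply/eqP => f1; rewrite f1 in fj.
    have Pj : P j by rewrite /P bj -xj nx.
    have le1 := min x cx fx; have le2 : (zv j <= zv k)%N := max j Pj.
    move/eqP: xz; case; apply: val_inj; apply/eqP; rewrite eqn_leq le1 andbT.
    by rewrite [X in (val X <= _)%N]xj.
have supp_by x : n x != 0 -> (exists k, x = bv k) \/ (exists k, x = yv k).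
  move=> nx; case: (suppn x nx) => [|[j xj]|[j bj xj]]; [by left|by right; exists j|].
  by rewrite xj no_bottleneck ?eqxx in nx.
have sum_y c : c \notin codom bc -> \sum_k n (yv k) * A (yr k) c = 0.
  move=> cb; rewrite -[RHS](rel c) [RHS](bigID (fun x => x \in [set yv k | k : 'I_N])) /=.
  rewrite [X in _ = _ + X]big1 ?addr0 => [|x nxy].
    rewrite big_imset /=; last by move=> k j _ _; apply: yv_inj.
    by apply: eq_bigr => k _; rewrite coef_out.
  have [->|nx] := eqVneq (n x) 0; first by rewrite mul0r.
  case: (supp_by x nx) => [[j xj]|[j xj]]; last by rewrite xj imset_f in nxy.
  suff -> : coef c x = 0 by rewrite mulr0.
  apply/eqP; apply: contraT; rewrite xj => /coef_inp_neq0 jc.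
  by rewrite -jc codom_f in cb.
(* At most [M] triples are selected, so at most [3 * M <= s] of the [yv] occur; their rows would sum
   to zero on all columns outside [codom bc], against [A_rows]. *)
have ny k : n (yv k) = 0.
  pose J := [set k | n (yv k) != 0].
  apply/eqP; apply: contraT => nk.
  have J0 : J != set0 by apply/set0Pn; exists k; rewrite inE.
  have cJ : (#|J| <= s)%N.
    apply: leq_trans cardn; rewrite -(card_imset _ yv_inj).
    by apply/subset_leq_card/subsetP => _ /imsetP[j Jj ->]; move: Jj; rewrite !in_set.
  have [c cb /eqP[]] := A_rows J0 cJ.
  rewrite -[RHS](sum_y c cb) big_mkcond; apply: eq_bigr => j _; rewrite inE.
  by case: eqVneq => [->|/F2_neq0 ->]; rewrite ?mul0r ?mul1r.
have [x nx] : exists x, n x != 0 := formal_neq0 q0.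
(* Only the inputs [bv k] remain, and distinct inputs are linearly independent. *)
case: (supp_by x nx) => [[k xk]|[k xk]]; last by rewrite xk ny eqxx in nx.
have := rel (bc k); rewrite (bigD1 x) //= big1 => [|x' xx'].
  by move/eqP; rewrite addr0 xk coef_inp eqxx mulr1 -xk (negPf nx).
have [->|nx'] := eqVneq (n x') 0; first by rewrite mul0r.
case: (supp_by x' nx') => [[j xj]|[j xj]]; last by rewrite xj ny eqxx in nx'.
suff -> : coef (bc k) x' = 0 by rewrite mulr0.
apply/eqP; apply: contraT; rewrite xj => /coef_inp_neq0 jk.
by move: xx'; rewrite xj xk /bv jk eqxx.
Qed.

Lemma card_imset_inj (f : 'I_N -> vertex) : injective f -> #|[set f k | k : 'I_N]| = N.
Proof. by move=> f_inj; rewrite card_imset // card_ord. Qed.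

Lemma leq_N_m : (N <= m)%N.
Proof. by have := leq_card bc bc_inj; rewrite !card_ord. Qed.

Lemma card_other_outputs : (#|other_outputs| <= m - N)%N.
Proof.
apply: leq_trans (leq_imset_card _ _) _.
have -> : [set i | i \notin codom yr] = ~: [set yr k | k : 'I_N].
  by apply/setP => i; rewrite !inE; congr (~~ _); apply/codomP/imsetP => [[k ->]|[k _ ->]]; exists k.
by rewrite cardsCs setCK card_imset // !card_ord.
Qed.

Lemma disjoint_bz : [disjoint [set bv k | k : 'I_N] & [set zv k | k : 'I_N]].
Proof.
apply/pred0P => x /=; apply/negP => /andP[/imsetP[k _ ->] /imsetP[j _ /eqP]].
by rewrite eq_sym (negPf (zv_neq_bv _ _)).
Qed.

Lemma card_known : #|known| = (2 * N)%N.
Proof.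
rewrite /known cardsU (disjoint_setI0 disjoint_bz) cards0 subn0.
by rewrite !card_imset_inj; [lia | exact: zv_inj | exact: bv_inj].
Qed.

(** For bad [k], [zv k] has fan at least two and lies in the triple computing it. Otherwise [yv k]
    lies in the triple computing it, and the fans of [bv k] and [yv k] total at least two, since
    [bv k] has fan at least one and [bad k] fails. *)
Lemma degree_bv_zv k :
  (3 <= degree merged_triple (bv k) + degree merged_triple (zv k) +
    ((bv k \in other_outputs) + (zv k \in other_outputs)))%N.
Proof.
have [bk|gk] := boolP (bad k).
  have [_ fz _ _] := bad_zv bk; have [g zg] := zv_head k.
  have -> : degree merged_triple (zv k) = (#|users (zv k)|).+1.
    by rewrite zg degree_head // => j _; rewrite -zg zv_neq_yv.
  by move: fz; rewrite /fan; case: (zv k \in other_outputs) => /=; lia.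
have zk : zv k = yv k by rewrite /zv (negPf gk).
rewrite zk degree_inp; last by move=> j bj; apply: contraNneq gk => /bv_inj ->.
have -> : degree merged_triple (yv k) = (#|users (yv k)|).+1.
  have [g yg] := yv_head k; rewrite yg degree_head // => j bj.
  by rewrite -yg; apply: contraNneq gk => /yv_inj ->.
have fb : (0 < #|users (bv k)| + (bv k \in other_outputs))%N.
  case: (used (bv k)) => [/codomP[i bi]|[i gi]].
    rewrite addn_gt0; apply/orP; right; rewrite bi lt0b; apply/imsetP; exists i => //.
    rewrite inE; apply/negP => /codomP[j ij].
    by have := yv_neq_bv j k; rewrite bi ij eqxx.
  rewrite addn_gt0; apply/orP; left; apply/card_gt0P; exists i; by rewrite mem_users.
move: gk fb; rewrite /bad /fan negb_and (negPf (yv_notin_other_outputs k)) -/(bv k) !addn0.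
by case: (bv k \in other_outputs) => /=; lia.
Qed.

Lemma sum_known (F : vertex -> nat) :
  (\sum_(x in known) F x = \sum_k F (bv k) + \sum_k F (zv k))%N.
Proof.
rewrite (eq_bigl [predU [set bv k | k : 'I_N] & [set zv k | k : 'I_N]]); last first.
  by move=> x; rewrite in_known.
rewrite bigU ?disjoint_bz //= !big_imset //=; last by move=> k j _ _; apply: bv_inj.
by move=> k j _ _; apply: zv_inj.
Qed.

Lemma known_degree : (3 * N <= \sum_(x in known) degree merged_triple x + (m - N))%N.
Proof.
rewrite sum_known.
have WK : (\sum_k ((bv k \in other_outputs) + (zv k \in other_outputs)) <= m - N)%N.
  apply: leq_trans card_other_outputs.
  apply: (@leq_trans #|other_outputs :&: known|); last by rewrite subset_leq_card // subsetIl.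
  have -> : (#|other_outputs :&: known| = \sum_(x in known) (x \in other_outputs))%N.
    by rewrite -sum1_card setIC big_mkcond [RHS]big_mkcond; apply: eq_bigr => x _;
      rewrite inE; case: (x \in known); case: (x \in other_outputs).
  by rewrite sum_known big_split.
apply: leq_trans (leq_add (leqnn _) WK).
rewrite -!big_split /= mulnC -[N in leqLHS]card_ord -sum_nat_const.
by apply: leq_sum => k _; apply: degree_bv_zv.
Qed.

(** A used gate has degree at least two. The exceptions are the inputs outside [codom bc], with a
    deficit of at most two, and the other outputs, with a deficit of at most one; there are at most
    [m - N] of each kind. *)
Lemma unknown_degree (Z : {set vertex}) : [disjoint Z & known] ->
  (2 * #|Z| <= \sum_(x in Z) degree merged_triple x + 3 * (m - N))%N.
Proof.
move=> dZ; pose F := [set inp j | j in ~: [set bc k | k : 'I_N]].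
have cF : (#|F| <= m - N)%N.
  apply: leq_trans (leq_imset_card _ _) _.
  by rewrite cardsCs setCK card_imset // !card_ord.
have bound x : x \in Z -> (2 <= degree merged_triple x + (2 * (x \in F) + (x \in other_outputs)))%N.
  move=> Zx; have nK : x \notin known by rewrite (disjointFr dZ Zx).
  case: (vertexP x) => [[j xj]|[g xg]].
    suff -> : x \in F by lia.
    rewrite xj; apply: imset_f; rewrite inE; apply: contra nK => /imsetP[k _ jk].
    by rewrite in_known xj jk; apply/orP; left; apply: (imset_f bv).
  have [/existsP[k /andP[bk /eqP ->]]|no] := boolP [exists k, bad k && (x == yv k)].
    by rewrite degree_yv.
  rewrite xg degree_head -xg; last first.
    by move=> k bk; apply: contraNneq no => xy; apply/existsP; exists k; rewrite bk xy eqxx.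
  case: (used x) => [/codomP[i xi]|[i gi]].
    suff -> : x \in other_outputs by lia.
    rewrite xi; apply: imset_f; rewrite inE; apply: contra nK => /codomP[k ik].
    rewrite in_known; apply/orP; right; apply/imsetP; exists k => //.
    rewrite xi ik /zv -/(yv k); case: ifP => // bk; case/negP: no; apply/existsP; exists k.
    by rewrite bk xi ik eqxx.
  have : (0 < #|users x|)%N by apply/card_gt0P; exists i; rewrite mem_users.
  lia.
have FW : (\sum_(x in Z) (2 * (x \in F) + (x \in other_outputs)) <= 3 * (m - N))%N.
  have countP (B : {set vertex}) : (\sum_(x in Z) (x \in B) <= #|B|)%N.
    rewrite -sum1_card big_mkcond [leqRHS]big_mkcond; apply: leq_sum => x _.
    by case: (x \in Z); case: (x \in B).
  rewrite big_split /= -big_distrr /= (mulSn 2) [leqRHS]addnC leq_add //.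
    by rewrite leq_mul2l (leq_trans (countP F) cF) orbT.
  exact: leq_trans (countP other_outputs) card_other_outputs.
apply: leq_trans (leq_add (leqnn _) FW).
rewrite -big_split /= mulnC -sum_nat_const.
by apply: leq_sum => x; apply: bound.
Qed.

Lemma program_bound h l : (0 < h)%N -> (m + G < 2 ^ l)%N ->
  (3 * ((2 * (h * l) + 3) * (3 * 2 ^ h)) <= s)%N ->
  (4 * h * m <= 9 * h * (m - N) + h * G + 3 * (m + G))%N.
Proof.
move=> h0 lX Ms.
have := @known_degree_bound _ _ merged_triple known h l (3 * (m - N)) card_merged_triple h0.
rewrite card_ord => /(_ lX (known_independent Ms) unknown_degree).
rewrite cardsCs setCK card_known card_ord.
apply: program_bound_arith leq_N_m _ known_degree.
by rewrite subnK // -card_known; apply: leq_trans (max_card _) _; rewrite card_ord.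
Qed.

End Assembly.

End Program.

(** * From products of gates to straight-line programs *)

Lemma is_productP n (S : {set 'M['F_2]_n}) A k :
  reflect (exists2 gs : seq 'M['F_2]_n, size gs = k & {subset gs <= S} /\ \prod_(g <- gs) g = A)
    (is_product S A k).
Proof.
apply: (iffP existsP) => [[gs /andP[/allP sS /eqP pA]]|[gs <- [sS pA]]].
  by exists gs; [rewrite size_tuple | split].
by exists (in_tuple gs); rewrite pA eqxx andbT; apply/allP.
Qed.

Lemma row_two_local n (i j a : 'I_n) B (M : 'M['F_2]_n) : i != j ->
  row a (two_local i j B *m M) =
    if a == i then B 0 0 *: row i M + B 0 1 *: row j M
    else if a == j then B 1 0 *: row i M + B 1 1 *: row j M else row a M.
Proof.
move=> ij; apply/rowP => c; rewrite !mxE.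
have two (x y : 'F_2) : \sum_k (if k == i then x else if k == j then y else 0) * M k c =
    x * M i c + y * M j c.
  have ji : j != i by rewrite eq_sym.
  rewrite (bigD1 i) //= eqxx (bigD1 j) //= (negPf ji) eqxx.
  by rewrite big1 ?addr0 // => k /andP[/negPf-> /negPf->]; rewrite mul0r.
case: eqP => [->|ai].
  by under eq_bigr => k _ do rewrite mxE eqxx; rewrite two !mxE.
case: eqP => [->|aj].
  under eq_bigr => k _ do rewrite mxE eq_sym (negPf ij) eqxx.
  by rewrite two !mxE.
under eq_bigr => k _ do rewrite mxE (introF eqP ai) (introF eqP aj).
rewrite (bigD1 a) //= eqxx mul1r big1 ?addr0 ?mxE // => k ka.
by rewrite eq_sym (negPf ka) mul0r.
Qed.

(** Vertices are natural numbers here, so that appending a gate changes the functions at the single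
    point [m + G] and leaves all types alone. *)
Record straight_line m G (M : 'M['F_2]_m) (w : nat -> 'rV['F_2]_m)
    (u1 u2 : nat -> nat) (o : 'I_m -> nat) : Prop := StraightLine {
  sl_inp : forall j : 'I_m, w j = delta_mx 0 j;
  sl_lt : forall x, (m <= x < m + G)%N -> (u1 x < x)%N /\ (u2 x < x)%N;
  sl_neq : forall x, (m <= x < m + G)%N -> u1 x != u2 x;
  sl_val : forall x, (m <= x < m + G)%N -> w x = w (u1 x) + w (u2 x);
  sl_inj : injective o;
  sl_out_lt : forall i, (o i < m + G)%N;
  sl_out : forall i, w (o i) = row i M;
  sl_used : forall x, (x < m + G)%N -> (exists i, x = o i) \/
    exists2 y, (m <= y < m + G)%N & x = u1 y \/ x = u2 y }.

Lemma straight_line1 m : straight_line 0 1%:M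
  (fun x => if insub x is Some j then delta_mx 0 j else 0) (fun=> 0%N) (fun=> 0%N) (@nat_of_ord m).
Proof.
have none x : (m <= x < m + 0)%N = false by rewrite addn0; lia.
split=> [j|x|x|x||i|i|x]; rewrite ?none // ?addn0 //.
- by rewrite valK.
- exact: val_inj.
- by rewrite valK; apply/rowP => c; rewrite !mxE eq_sym.
- by move=> xm; left; exists (Ordinal xm).
Qed.

Lemma straight_line_relabel m G (M M' : 'M['F_2]_m) w u1 u2 o (p : 'S_m) :
  straight_line G M w u1 u2 o -> (forall i, row i M' = row (p i) M) ->
  straight_line G M' w u1 u2 (o \o p).
Proof.
case=> h1 h2 h3 h4 h5 h6 h7 h8 rM; split=> //.
- by move=> i j /h5/perm_inj.
- by move=> i /=; rewrite h6.
- by move=> i /=; rewrite h7 rM.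
- move=> x /h8[[i ->]|]; [left|by right].
  by exists (p^-1%g i); rewrite /= permKV.
Qed.

Definition update T (n : nat) (f : nat -> T) (y : T) x := if x == n then y else f x.

(** Only wires [i] and [j] may lose their old output, and these outputs are the tails of the new
    gate; so every vertex is still used or an output. *)
Lemma straight_line_gate m G (M M' : 'M['F_2]_m) w u1 u2 o (i j : 'I_m) (o' : 'I_m -> nat) :
  straight_line G M w u1 u2 o -> i != j ->
  injective o' ->
  (forall a, o' a = (m + G)%N /\ row a M' = row i M + row j M \/
     exists2 b, o' a = o b & row a M' = row b M) ->
  (forall a, a != i -> a != j -> o' a = o a) ->
  (exists a, o' a = m + G)%N ->
  straight_line G.+1 M' (update (m + G) w (w (o i) + w (o j)))
    (update (m + G) u1 (o i)) (update (m + G) u2 (o j)) o'.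
Proof.
case=> h1 h2 h3 h4 h5 h6 h7 h8 ij inj' out' same' [a0 new'].
have old T (f : nat -> T) y x : (x < m + G)%N -> update (m + G) f y x = f x.
  by rewrite /update; case: eqP => // ->; rewrite ltnn.
have new T (f : nat -> T) y : update (m + G) f y (m + G)%N = y by rewrite /update eqxx.
have split_x x : (m <= x < m + G.+1)%N -> (m <= x < m + G)%N \/ x = (m + G)%N.
  by rewrite addnS ltnS [X in _ && X]leq_eqVlt => /andP[-> /orP[/eqP|] ->]; [right|left].
split=> //.
- by move=> k; rewrite old ?h1 // ltn_addr.
- move=> x /split_x[hx|->]; last by rewrite !new; split; apply: h6.
  by have /andP[_ lx] := hx; rewrite !old //; apply: h2.
- move=> x /split_x[hx|->]; last by rewrite !new; apply: contra_neq ij => /h5.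
  by have /andP[_ lx] := hx; rewrite !old //; apply: h3.
- move=> x /split_x[hx|->]; last by rewrite !new (old _ w _ _ (h6 i)) (old _ w _ _ (h6 j)).
  have [l1 l2] := h2 x hx; have /andP[_ lx] := hx.
  rewrite (old _ u1 _ _ lx) (old _ u2 _ _ lx) (old _ w _ _ lx).
  by rewrite (old _ w _ _ (ltn_trans l1 lx)) (old _ w _ _ (ltn_trans l2 lx)) h4.
- by move=> a; case: (out' a) => [[-> _]|[b -> _]]; rewrite addnS ltnS // ltnW.
- move=> a; case: (out' a) => [[-> ->]|[b -> ->]]; first by rewrite new !h7.
  by rewrite old // h7.
- move=> x; rewrite addnS ltnS leq_eqVlt => /orP[/eqP ->|lx].
    by left; exists a0.
  have top : (m <= m + G < (m + G).+1)%N by rewrite leq_addr /=.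
  case: (h8 x lx) => [[a xa]|[y hy xy]]; last first.
    right; exists y; first by case/andP: hy => -> /ltnW; rewrite ltnS.
    by rewrite !old //; case/andP: hy.
  have [ai|ai] := eqVneq a i.
    by right; exists (m + G)%N => //; rewrite !new; left; rewrite xa ai.
  have [aj|aj] := eqVneq a j.
    by right; exists (m + G)%N => //; rewrite !new; right; rewrite xa aj.
  by left; exists a; rewrite same'.
Qed.

Lemma F2_unitmx2 (B : 'M['F_2]_2) : B \in unitmx ->
  [/\ ~~ ((B 0 0 == 0) && (B 0 1 == 0)), ~~ ((B 1 0 == 0) && (B 1 1 == 0)) &
      ~~ ((B 0 0 == B 1 0) && (B 0 1 == B 1 1))].
Proof.
move=> /mulmxV BC.
have e i j : B i 0 * invmx B 0 j + B i 1 * invmx B 1 j = (i == j)%:R.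
  have /matrixP/(_ i j) := BC; rewrite !mxE big_ord_recl big_ord1 => <-.
  by congr (_ * _ + _ * _); congr (_ _ _); apply/val_inj.
split; apply/negP => /andP[/eqP e0 /eqP e1].
- by have := e 0 0; rewrite e0 e1 !mul0r addr0.
- by have := e 1 1; rewrite e0 e1 !mul0r addr0.
- by have := e 0 0; rewrite e0 e1 e.
Qed.

Lemma straight_line_xor m G (M M' : 'M['F_2]_m) w u1 u2 o (i j keep : 'I_m) :
  straight_line G M w u1 u2 o -> i != j -> keep = i \/ keep = j ->
  (forall a, row a M' = if a == i then row i M + row j M
                        else if a == j then row keep M else row a M) ->
  exists w' u1' u2' o', straight_line G.+1 M' w' u1' u2' o'.
Proof.
move=> sl ij keepij rM; have ji : j != i by rewrite eq_sym.
have [_ _ _ _ inj lt_o _ _] := sl.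
pose o' a := if a == i then (m + G)%N else if a == j then o keep else o a.
have o_new a : o a <> (m + G)%N by move=> e; have := lt_o a; rewrite e ltnn.
have keep_new a : a != i -> a != j -> o keep <> o a.
  by move=> ai aj /inj ka; case: keepij => ke; [case/eqP: ai|case/eqP: aj]; rewrite -ka.
do 4!eexists; apply: (straight_line_gate (o' := o') sl ij).
- move=> a b; rewrite /o'.
  have [->|ai] := eqVneq a i; have [->|bi] := eqVneq b i => //.
  + by case: eqP => _ e; case: (@o_new _ (esym e)).
  + by case: eqP => _ e; case: (@o_new _ e).
  have [->|aj] := eqVneq a j; have [->|bj] := eqVneq b j => //.
  + by move/(@keep_new b bi bj).
  + by move/esym/(@keep_new a ai aj).
  + exact: inj.
- move=> a; rewrite rM /o'; case: (a == i); first by left.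
  by right; case: (a == j); [exists keep|exists a].
- by move=> a /negPf ai /negPf aj; rewrite /o' ai aj.
- by exists i; rewrite /o' eqxx.
Qed.

Lemma straight_line_step m G (M : 'M['F_2]_m) w u1 u2 o (i j : 'I_m) B :
  straight_line G M w u1 u2 o -> i != j -> B \in unitmx ->
  exists G' w' u1' u2' o', (G' <= G.+1)%N /\
    straight_line G' (two_local i j B *m M) w' u1' u2' o'.
Proof.
move=> sl ij Bu; have ji : j != i by rewrite eq_sym.
have rM a := row_two_local a B M ij.
have xor k l keep : k != l -> keep = k \/ keep = l ->
  (forall a, row a (two_local i j B *m M) = if a == k then row k M + row l M
                        else if a == l then row keep M else row a M) ->
  exists G' w' u1' u2' o', (G' <= G.+1)%N /\
    straight_line G' (two_local i j B *m M) w' u1' u2' o'.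
  move=> kl hk rM'; have [w' [u1' [u2' [o' sl']]]] := straight_line_xor sl kl hk rM'.
  by exists G.+1, w', u1', u2', o'.
have relabel (p : 'S_m) : (forall a, row a (two_local i j B *m M) = row (p a) M) ->
  exists G' w' u1' u2' o', (G' <= G.+1)%N /\
    straight_line G' (two_local i j B *m M) w' u1' u2' o'.
  move=> rM'; exists G, w, u1, u2, (o \o p); split; first exact: leqnSn.
  exact: straight_line_relabel sl rM'.
(* Six of the sixteen matrices survive: two permutations, which cost no gate, and four with one row
   [(1, 1)] and one unit row, which cost one XOR gate. *)
move: (F2_unitmx2 Bu) rM.
case: (F2_cases (B 0 0)) => ->; case: (F2_cases (B 0 1)) => ->;
case: (F2_cases (B 1 0)) => ->; case: (F2_cases (B 1 1)) => -> [] //= _ _ _ rM.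
- apply: (relabel (tperm i j)) => a; rewrite rM !scale0r !scale1r addr0 add0r.
  by case: tpermP => [->|->|/eqP/negPf-> /eqP/negPf->]; rewrite ?eqxx ?(negPf ji).
- apply: (xor j i j ji); first by left.
  move=> a; rewrite rM !scale0r !scale1r add0r addrC.
  by case: (eqVneq a i) => [->|//]; rewrite (negPf ij).
- apply: (relabel 1%g) => a; rewrite rM perm1 !scale0r !scale1r addr0 add0r.
  by case: eqP => [->|_] //; case: eqP => [->|].
- apply: (xor j i i ji); first by right.
  move=> a; rewrite rM !scale0r !scale1r addr0 addrC.
  by case: (eqVneq a i) => [->|//]; rewrite (negPf ij).
- apply: (xor i j j ij); first by right.
  by move=> a; rewrite rM !scale0r !scale1r add0r.
- apply: (xor i j i ij); first by left.
  by move=> a; rewrite rM !scale0r !scale1r addr0.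
Qed.

Lemma product_straight_line m (gs : seq 'M['F_2]_m) :
  {subset gs <= two_local_gates m} -> exists G w u1 u2 o, (G <= size gs)%N /\
    straight_line G (\prod_(g <- gs) g) w u1 u2 o.
Proof.
elim: gs => [|g gs IH] sub.
  do 5!eexists; rewrite big_nil; split; last exact: straight_line1.
  by [].
have [x xs|G [w [u1 [u2 [o [leG sl]]]]]] := IH; first by apply: sub; rewrite inE xs orbT.
have := sub g (mem_head _ _); rewrite inE => /existsP[i /existsP[j /existsP[B /and3P[ij Bu /eqP ->]]]].
have ij' : i != j by rewrite neq_ltn ij.
have [G' [w' [u1' [u2' [o' [leG' sl']]]]]] := straight_line_step sl ij' Bu.
exists G', w', u1', u2', o'; rewrite big_cons; split=> //.
by rewrite (leq_trans leG').
Qed.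

Lemma two_local_lower_bound m (A : 'M['F_2]_m) k N s (yr bc : 'I_N -> 'I_m) h l :
  is_product (two_local_gates m) A k ->
  injective yr -> injective bc ->
  (forall i j, A (yr i) (bc j) = (i == j)%:R) -> (0 < s)%N ->
  (forall J : {set 'I_N}, J != set0 -> (#|J| <= s)%N ->
     exists2 c, c \notin codom bc & \sum_(i in J) A (yr i) c != 0) ->
  (forall i, exists2 r, r \notin codom yr & A r (bc i) != 0) ->
  (0 < h)%N -> (m + k < 2 ^ l)%N ->
  (3 * ((2 * (h * l) + 3) * (3 * 2 ^ h)) <= s)%N ->
  (4 * h * m <= 9 * h * (m - N) + h * k + 3 * (m + k))%N.
Proof.
case/is_productP => gs szk [sub pA] yr_inj bc_inj A_diag s0 A_rows A_col h0 ltl les.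
have [G [w [u1 [u2 [o [leG sl]]]]]] := product_straight_line sub.
rewrite pA szk in leG sl; case: sl => h1 h2 h3 h4 h5 h6 h7 h8.
have hd (g : 'I_G) : (m <= m + g < m + G)%N by rewrite leq_addr ltn_add2l /=.
pose lt1 g := let: conj p _ := h2 _ (hd g) in p.
pose lt2 g := let: conj _ p := h2 _ (hd g) in p.
pose t1 g : 'I_(m + G) := Ordinal (ltn_trans (lt1 g) (ltn_ord (rshift m g))).
pose t2 g : 'I_(m + G) := Ordinal (ltn_trans (lt2 g) (ltn_ord (rshift m g))).
pose oo i : 'I_(m + G) := Ordinal (h6 i).
pose v (x : 'I_(m + G)) := w x.
have bound : (4 * h * m <= 9 * h * (m - N) + h * G + 3 * (m + G))%N.
  apply: (@program_bound m G v t1 t2 _ _ _ _ _ oo A N s yr bc _ _ _ _ _ _ _ _ _ h l) => //.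
  - by move=> g; apply: (h4 _ (hd g)).
  - by move=> g; rewrite -val_eqE; apply: (h3 _ (hd g)).
  - by move=> i j /(congr1 val)/h5.
  - move=> x; case: (h8 x (ltn_ord x)) => [[i xi]|[y /andP[my ylt] xy]]; [left|right].
      by apply/codomP; exists i; apply: val_inj.
    have ym : (y - m < G)%N by rewrite ltn_subLR.
    exists (Ordinal ym); rewrite !inE -!val_eqE /= subnKC //.
    by case: xy => ->; rewrite eqxx ?orbT.
  - by apply: leq_ltn_trans ltl; rewrite leq_add2l.
apply: leq_trans bound _.
by rewrite -!addnA leq_add2l leq_add ?leq_mul ?leq_add2l.
Qed.

(** * Generation of the general linear group by transvections *)

Section Transvections.
Variable n : nat.
Implicit Types (i j : 'I_n) (A : 'M['F_2]_n).

Definition transvection i j : 'M['F_2]_n := 1%:M + delta_mx i j.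

Lemma transvectionE i j A a b :
  (transvection i j *m A) a b = A a b + (a == i)%:R * A j b.
Proof.
rewrite mulmxDl mul1mx mxE; congr (_ + _); rewrite mxE (bigD1 j) //= !mxE eqxx andbT.
by rewrite big1 ?addr0 // => c /negPf cj; rewrite mxE cj andbF mul0r.
Qed.

Lemma transvection_invol i j : i != j -> transvection i j *m transvection i j = 1%:M.
Proof.
move=> ij; apply/matrixP => a b; rewrite transvectionE !mxE.
rewrite [j == i]eq_sym (negPf ij) addr0.
have [->|ai] := eqVneq a i; last by rewrite mul0r !addr0.
by rewrite mul1r eq_sym [b == j]eq_sym -addrA F2_addK addr0 eq_sym.
Qed.

Lemma transvection_unit i j : i != j -> transvection i j \in unitmx.
Proof. by move=> /transvection_invol/mulmx1_unit[]. Qed.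

Lemma transvection_in i j : i != j -> transvection i j \in transvections n.
Proof. by move=> ij; rewrite inE; apply/existsP; exists i; apply/existsP; exists j; rewrite ij /=. Qed.

Definition generated A := exists k, is_product (transvections n) A k.

Lemma generated1 : generated 1%:M.
Proof. by exists 0%N; apply/is_productP; exists [::]; rewrite // big_nil. Qed.

Lemma generated_transvection i j A : i != j ->
  generated (transvection i j *m A) -> generated A.
Proof.
move=> ij [k /is_productP[gs szk [sub pA]]]; exists k.+1; apply/is_productP.
exists (transvection i j :: gs); first by rewrite /= szk.
split; last first.
  by rewrite big_cons pA; apply: (etrans (mulmxA _ _ _)); rewrite transvection_invol // mul1mx.
by move=> g; rewrite inE => /orP[/eqP ->|/sub //]; apply: transvection_in.
Qed.

Definition cleared (k : nat) A := forall i j, (j < k)%N -> A i j = (i == j)%:R.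

Lemma cleared_transvection k i j A : cleared k A -> (k <= j)%N -> cleared k (transvection i j *m A).
Proof.
move=> cA kj a b bk; rewrite transvectionE !cA //.
have -> : (j == b) = false by apply/eqP => jb; rewrite -jb ltnNge kj in bk.
by rewrite mulr0 addr0.
Qed.

(** Otherwise column [k] would be a combination of the earlier columns, which are unit vectors, and
    [x] records the resulting kernel vector. *)
Lemma cleared_pivot (k : 'I_n) A : A \in unitmx -> cleared k A ->
  exists2 i : 'I_n, (k <= i)%N & A i k != 0.
Proof.
move=> uA cA; have [i /andP[ki nz]|no] := pickP (fun i : 'I_n => (k <= i)%N && (A i k != 0)).
  by exists i.
have zero (i : 'I_n) : (k <= i)%N -> A i k = 0.
  by move=> ki; have := no i; rewrite ki /= => /negbFE/eqP.
pose x : 'cV['F_2]_n := \col_i (if i == k then 1 else if (i < k)%N then A i k else 0).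
have Ax : A *m x = 0.
  apply/matrixP => r c; rewrite !mxE (bigD1 k) //= mxE eqxx mulr1.
  have [rk|kr] := ltnP r k.
    rewrite (bigD1 r) /=; last by apply: contraTneq rk => ->; rewrite ltnn.
    rewrite mxE rk (cA r r rk) eqxx mul1r (_ : (r == k) = false); last first.
      by apply/eqP => e; rewrite e ltnn in rk.
    rewrite big1 ?addr0 ?F2_addK // => j /andP[/negPf jk jr]; rewrite mxE jk.
    by case: ifP => lj; rewrite ?mulr0 // (cA r j lj) eq_sym (negPf jr) mul0r.
  rewrite zero // add0r big1 // => j /negPf jk; rewrite mxE jk.
  case: ifP => lj; rewrite ?mulr0 // (cA r j lj); case: eqP => [rj|_]; rewrite ?mul0r //.
  by rewrite -rj ltnNge kr in lj.
have x0 : x = 0 by rewrite -(mulKmx uA x) Ax mulmx0.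
by have := congr1 (fun y : 'cV_n => y k 0) x0; rewrite !mxE eqxx.
Qed.

(** Gauss-Jordan elimination without row swaps: a zero pivot is repaired by adding a lower row. It
    ensures that both lengths of an invertible matrix are attained minima and not the default
    value. *)
Lemma transvections_generate A : A \in unitmx -> generated A.
Proof.
move=> uA; have c0 : cleared 0 A by [].
have [d] : {d | d = n - 0}%N by exists (n - 0)%N.
move: 0%N (leq0n n) c0 => k; elim: d k A uA => [|d IH] k A uA lekn cA dk.
  suff -> : A = 1%:M by exact: generated1.
  by apply/matrixP => i j; rewrite cA ?mxE // (leq_trans (ltn_ord j)) //; lia.
have ltkn : (k < n)%N by lia.
pose kk := Ordinal ltkn.
have cleared_column B : B \in unitmx -> cleared k B -> B kk kk = 1 -> generated B.
  have [e] := ubnP #|[set i | (i != kk) && (B i kk != 0)]|.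
  elim: e B => // e IHe B leB uB cB B1.
  have [B0|[i]] := set_0Vmem [set i | (i != kk) && (B i kk != 0)].
    apply: (IH k.+1) => //; last by lia.
    move=> i j; rewrite ltnS leq_eqVlt => /orP[/eqP jk|]; last exact: cB.
    have -> : j = kk by apply: val_inj.
    have [->//|ik] := eqVneq i kk.
    by have /setP/(_ i) := B0; rewrite !inE ik /= => /negbFE/eqP.
  rewrite inE => /andP[ik Bi]; apply: (generated_transvection ik).
  apply: IHe.
  - rewrite -ltnS; apply: leq_trans leB; rewrite ltnS; apply: proper_card.
    apply/properP; split.
      apply/subsetP => a; rewrite !inE transvectionE => /andP[-> /=].
      have [->|_] := eqVneq a i; last by rewrite mul0r addr0.
      by rewrite Bi.
    exists i; rewrite !inE ?ik ?Bi // transvectionE eqxx B1 (F2_neq0 Bi).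
    by rewrite mul1r F2_addK eqxx.
  - by rewrite unitmx_mul transvection_unit.
  - exact: cleared_transvection.
  - by rewrite transvectionE B1 eq_sym (negPf ik) mul0r addr0.
have [A0|/F2_neq0 A1] := eqVneq (A kk kk) 0; last exact: cleared_column.
have [i ki Ai] := @cleared_pivot kk A uA cA.
have ik : kk != i by apply: contraNneq Ai => <-; rewrite A0.
apply: (generated_transvection ik); apply: cleared_column.
- by rewrite unitmx_mul transvection_unit.
- exact: cleared_transvection.
- by rewrite transvectionE A0 eqxx (F2_neq0 Ai) mulr1 add0r.
Qed.

Lemma transvection_two_local : {subset transvections n <= two_local_gates n}.
Proof.
move=> g; rewrite inE => /existsP[i /existsP[j /andP[ij /eqP ->]]].
have unitB (a b : 'I_2) : a != b -> (1%:M + delta_mx a b : 'M['F_2]_2) \in unitmx.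
  move=> ab.
  suff /mulmx1_unit[] : (1%:M + delta_mx a b) *m (1%:M + delta_mx a b) = 1%:M :> 'M['F_2]_2 by [].
  rewrite mulmxDl mul1mx mulmxDr mulmx1 mul_delta_mx_0 1?eq_sym // addr0.
  by rewrite -addrA F2_add_self addr0.
rewrite inE; case: (ltngtP i j) => [lij|lji|/val_inj eij]; last by rewrite eij eqxx in ij.
  apply/existsP; exists i; apply/existsP; exists j; apply/existsP; exists (1%:M + delta_mx 0 1).
  rewrite lij unitB //=; apply/eqP/matrixP => a b; rewrite !mxE.
  case: (eqVneq a i) => [->|ai] /=; last by case: (eqVneq a j) => [->|aj] /=;
    rewrite addr0 // ?[j == b]eq_sym;
    case: (eqVneq b i) => [->|bi] /=; rewrite ?(negPf ij) ?addr0 ?add0r //; case: eqP.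
  rewrite [i == b]eq_sym; case: (eqVneq b i) => [->|bi] /=; first by rewrite (negPf ij) !addr0.
  by rewrite !add0r; case: eqP.
apply/existsP; exists j; apply/existsP; exists i; apply/existsP; exists (1%:M + delta_mx 1 0).
rewrite lji unitB //=; apply/eqP/matrixP => a b; rewrite !mxE.
have ji : j != i by rewrite eq_sym.
case: (eqVneq a j) => [->|aj] /=.
  rewrite (negPf ji) /= !addr0 [j == b]eq_sym; case: (eqVneq b j) => [_|bj] //=.
  by case: eqP.
case: (eqVneq a i) => [->|ai] /=; last by rewrite addr0.
rewrite [i == b]eq_sym; case: (eqVneq b j) => [->|bj] /=; first by rewrite (negPf ji) !add0r.
by rewrite !addr0; case: eqP => _; rewrite ?addr0.
Qed.

End Transvections.

(** * Power sums over the field and the matrix U *)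

Section FieldSums.
Variables (L : fieldExtType 'F_2) (N p : nat) (alpha : 'I_N -> L) (b : p.-tuple L).
Hypothesis N_def : N.+1 = (2 ^ p)%N.
Hypothesis alpha_inj : injective alpha.
Hypothesis alpha_nz : forall x : L, x != 0 <-> exists k, alpha k = x.
Hypothesis b_basis : basis_of fullv b.

Lemma alpha_neq0 k : alpha k != 0.
Proof. by apply/alpha_nz; exists k. Qed.

Lemma alpha_mul k0 : exists2 h : 'I_N -> 'I_N, injective h &
  forall k, alpha (h k) = alpha k0 * alpha k.
Proof.
have /fin_all_exists[h hP] k : exists k', alpha k' = alpha k0 * alpha k.
  by apply/alpha_nz; rewrite mulf_neq0 ?alpha_neq0.
exists h => // i j hij; apply/alpha_inj/(mulfI (alpha_neq0 k0)).
by rewrite -!hP hij.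
Qed.

(** As [X^e - 1] has at most [e] roots, some nonzero element has [e]-th power different from 1;
    multiplication by it permutes the nonzero elements and scales the sum by that power. *)
Lemma sum_powers0 e : (0 < e < N)%N -> \sum_k alpha k ^+ e = 0.
Proof.
case/andP=> e0 eN; have [k0 yk0] : exists k0, alpha k0 ^+ e != 1.
  have [k0 yk0|no] := pickP (fun k => alpha k ^+ e != 1); first by exists k0.
  have P0 : 'X^e - 1 != 0 :> {poly L} by rewrite -size_poly_eq0 size_XnsubC.
  have := max_poly_roots P0 (rs := [seq alpha k | k <- enum 'I_N]).
  rewrite size_XnsubC // size_map size_enum_ord ltnS [(N <= e)%N]leqNgt eN.
  rewrite (map_inj_uniq alpha_inj) enum_uniq => H; suff: false by [].
  apply: H => //; apply/allP => _ /mapP[k _ ->].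
  by rewrite rootE !hornerE; have := no k => /negbFE/eqP ->; rewrite subrr.
have [h h_inj hP] := alpha_mul k0.
set S := \sum_k _.
have : S = alpha k0 ^+ e * S.
  rewrite {1}/S (reindex_inj h_inj) mulr_sumr; apply: eq_bigr => k _.
  by rewrite hP exprMn.
move/eqP; rewrite -subr_eq0 -{1}[S]mul1r -mulrBl mulf_eq0 subr_eq0 eq_sym (negPf yk0).
by move/eqP.
Qed.

Lemma alpha_expN k : alpha k ^+ N = 1.
Proof.
have [h h_inj hP] := alpha_mul k.
have P0 : \prod_j alpha j != 0 by apply/prodf_neq0 => j _; apply: alpha_neq0.
apply: (mulIf P0); rewrite mul1r [RHS](reindex_inj h_inj).
under [RHS]eq_bigr => j _ do rewrite hP.
by rewrite big_split /= prodr_const card_ord.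
Qed.

Lemma alpha_exp2p k : alpha k ^+ (2 ^ p) = alpha k.
Proof. by rewrite -N_def exprS alpha_expN mulr1. Qed.

Lemma sum_exp2 (I : finType) (F : I -> L) w : (\sum_i F i) ^+ (2 ^ w) = \sum_i F i ^+ (2 ^ w).
Proof.
apply: (big_morph (fun x : L => x ^+ (2 ^ w))) => [x y|]; last by rewrite expr0n expn_eq0.
elim: w => [|w IH]; first by rewrite !expr1.
rewrite expnSr !exprM IH sqrrD -mulr_natr (_ : 2%:R = 0) ?mulr0 ?addr0 //.
by rewrite -scaler_nat (_ : 2%:R = 0 :> 'F_2) ?scale0r //; apply/val_inj.
Qed.

Lemma F2_expr (x : 'F_2) n : (0 < n)%N -> x ^+ n = x.
Proof. by case: n => // n _; case: (F2_cases x) => ->; rewrite ?expr1n // expr0n. Qed.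

Lemma coord_sum x : x = \sum_i coord b i x *: b`_i.
Proof. exact: (coord_basis b_basis (memvf x)). Qed.

Lemma coord_sum_exp2 x w : x ^+ (2 ^ w) = \sum_i coord b i x *: b`_i ^+ (2 ^ w).
Proof.
rewrite {1}[x]coord_sum sum_exp2; apply: eq_bigr => i _.
by rewrite exprZn F2_expr // expn_gt0.
Qed.

Definition moore : 'M[L]_p := \matrix_(w, j) b`_j ^+ (2 ^ w).

(** A relation between the rows of this Moore matrix is a linearized polynomial of degree at most
    [2 ^ p.-1] vanishing on the basis, hence, by additivity, on all [2 ^ p] elements of the
    field. *)
Lemma moore_unit : moore \in unitmx.
Proof.
rewrite -row_free_unit; apply: inj_row_free => d dM.
pose P := \sum_(w < p) d 0 w *: 'X^(2 ^ w).
have P_root x : P.[x] = 0.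
  rewrite horner_sum; under eq_bigr => w _ do rewrite hornerZ hornerXn coord_sum_exp2 mulr_sumr.
  rewrite exchange_big big1 //= => j _.
  under eq_bigr => w _ do rewrite -scalerAr.
  rewrite -scaler_sumr; have := congr1 (fun r : 'rV_p => r 0 j) dM.
  by rewrite !mxE; under eq_bigr => w _ do rewrite mxE; move=> ->; rewrite scaler0.
have P0 : P = 0.
  apply/eqP; apply: contraT => Pn0.
  have := max_poly_roots Pn0 (rs := 0 :: [seq alpha k | k <- enum 'I_N]).
  rewrite /= size_map size_enum_ord (map_inj_uniq alpha_inj) enum_uniq andbT N_def => H.
  suff : (2 ^ p < size P)%N.
    apply: contraTT => _; rewrite -leqNgt; apply: leq_trans (size_sum _ _ _) _.
    apply/bigmax_leqP => w _; apply: leq_trans (size_scale_leq _ _) _.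
    by rewrite size_polyXn ltn_exp2l.
  apply: H; first by rewrite rootE P_root eqxx; apply/allP => x _; rewrite rootE P_root.
  by apply/mapP => -[k _ k0]; have := alpha_neq0 k; rewrite -k0 eqxx.
apply/rowP => w; rewrite !mxE; have := congr1 (fun Q : {poly L} => Q`_(2 ^ w)) P0.
rewrite coef0 coef_sum (bigD1 w) //= coefZ coefXn eqxx mulr1 big1 ?addr0 // => v vw.
by rewrite coefZ coefXn eqn_exp2l // eq_sym (inj_eq val_inj) (negPf vw) mulr0.
Qed.

Lemma twisted_sum0 s t t' w : (s * 2 ^ p./2 + s < N)%N -> (t < s)%N -> (t' < s)%N -> (w < p)%N ->
  \sum_k alpha k ^+ t.+1 * (alpha k ^+ t'.+1) ^+ (2 ^ w) = 0.
Proof.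
move=> sN ts t's wp.
have small u u' v : (u < s)%N -> (u' < s)%N -> (v <= p./2)%N -> (0 < u.+1 + u'.+1 * 2 ^ v < N)%N.
  move=> us u's vp; rewrite addSn /=; apply: leq_ltn_trans sN; rewrite -addSn addnC.
  by rewrite leq_add // leq_mul // leq_exp2l.
have [wh|hw] := leqP w p./2.
  by rewrite -[RHS](sum_powers0 (small t t' w ts t's wh)); apply: eq_bigr => k _; rewrite exprD exprM.
(* For large [w], raising to the power [2 ^ (p - w)] moves the twist to the other factor, so that
   the exponent stays below [N]. *)
have ph : (p - w <= p./2)%N by have := odd_double_half p; lia.
suff : (\sum_k alpha k ^+ t.+1 * (alpha k ^+ t'.+1) ^+ (2 ^ w)) ^+ (2 ^ (p - w)) = 0.
  by move/eqP; rewrite expf_eq0 => /andP[_ /eqP].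
rewrite sum_exp2 -[RHS](sum_powers0 (small t' t (p - w)%N t's ts ph)).
apply: eq_bigr => k _.
have back : ((alpha k ^+ t'.+1) ^+ (2 ^ w)) ^+ (2 ^ (p - w)) = alpha k ^+ t'.+1.
  by rewrite -exprM -expnD subnKC ?(ltnW wp) // -exprM mulnC exprM alpha_exp2p.
by rewrite exprMn back -exprM mulrC -exprD.
Qed.

(** Expanding both factors of the twisted sums in the basis turns their vanishing for all [w] into
    [moore *m c = 0]; then [c] vanishes, and freeness of the basis gives each entry of [C]. *)
Lemma coord_orthogonal s t t' i j : (s * 2 ^ p./2 + s < N)%N -> (t < s)%N -> (t' < s)%N ->
  \sum_k coord b i (alpha k ^+ t.+1) * coord b j (alpha k ^+ t'.+1) = 0.
Proof.
move=> sN ts t's.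
pose C i j := \sum_k coord b i (alpha k ^+ t.+1) * coord b j (alpha k ^+ t'.+1).
pose c : 'cV[L]_p := \col_j \sum_i C i j *: b`_i.
have Mc : moore *m c = 0.
  apply/colP => w; rewrite mxE [RHS]mxE -[RHS](twisted_sum0 sN ts t's (ltn_ord w)).
  transitivity (\sum_k \sum_i \sum_j (coord b i (alpha k ^+ t.+1) * coord b j (alpha k ^+ t'.+1))
    *: (b`_i * b`_j ^+ (2 ^ w))).
    rewrite [RHS]exchange_big; under [RHS]eq_bigr => i' _ do rewrite exchange_big.
    rewrite [RHS]exchange_big; apply: eq_bigr => j' _ /=.
    rewrite !mxE mulr_sumr; apply: eq_bigr => i' _.
    by rewrite scaler_suml mulr_sumr; apply: eq_bigr => k _; rewrite -scalerAr [X in _ *: X = _]mulrC.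
  apply: eq_bigr => k _; rewrite [X in _ = X * _]coord_sum coord_sum_exp2 mulr_suml.
  apply: eq_bigr => i' _; rewrite mulr_sumr; apply: eq_bigr => j' _.
  by rewrite -scalerAl -scalerAr scalerA.
have c0 : c = 0 by rewrite -(mulKmx moore_unit c) Mc mulmx0.
have := congr1 (fun r : 'cV_p => r j 0) c0; rewrite !mxE => /(congr1 (coord b i)).
by rewrite coord_sum_free ?linear0 // (basis_free b_basis).
Qed.

(** Vandermonde argument: if all these sums vanished, so would the sum of [alpha k * Q.[alpha k]]
    over [J], where [Q] vanishes on [J] except at [k0]. The factor [alpha k] is there because the
    exponents start at 1. *)
Lemma powers_independent s (J : {set 'I_N}) : J != set0 -> (#|J| <= s)%N ->
  exists2 t, (t < s)%N & \sum_(k in J) alpha k ^+ t.+1 != 0.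
Proof.
move=> /set0Pn[k0 Jk0] Js.
have [t nz|no] := pickP (fun t : 'I_s => \sum_(k in J) alpha k ^+ t.+1 != 0); first by exists t.
have zero t : (t < s)%N -> \sum_(k in J) alpha k ^+ t.+1 = 0.
  by move=> ts; have := no (Ordinal ts) => /negbFE/eqP.
pose Q := \prod_(k in J :\ k0) ('X - (alpha k)%:P).
have sQ : (size Q <= s)%N.
  by rewrite /Q -big_enum size_prod_XsubC -cardE; rewrite (cardsD1 k0) Jk0 in Js.
have : \sum_(k in J) alpha k * Q.[alpha k] = 0.
  under eq_bigr => k _ do rewrite (horner_coef_wide _ sQ) mulr_sumr.
  rewrite exchange_big big1 //= => t _.
  under eq_bigr => k _ do rewrite mulrCA -exprS.
  by rewrite -mulr_sumr zero ?mulr0.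
rewrite (bigD1 k0) //= big1 ?addr0 => [|k /andP[Jk kk0]]; last first.
  rewrite /Q (bigD1 k) /=; last by rewrite !inE kk0.
  by rewrite hornerM hornerXsubC subrr mul0r mulr0.
move/eqP; rewrite mulf_eq0 (negPf (alpha_neq0 _)) /= horner_prod.
move/prodf_eq0 => [k]; rewrite !inE hornerXsubC subr_eq0 => /andP[kk0 _] /eqP/alpha_inj e.
by rewrite e eqxx in kk0.
Qed.

End FieldSums.

Lemma mulmx_castmx_col (F : pzSemiRingType) a b c d (e : c = d) (v : 'M[F]_(a, b)) (B : 'M[F]_(b, c)) :
  v *m castmx (erefl, e) B = castmx (erefl, e) (v *m B).
Proof. by case: _ / e. Qed.

Lemma castmx_col0 (F : pzSemiRingType) a c d (e : c = d) (B : 'M[F]_(a, c)) :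
  castmx (erefl, e) B = 0 -> B = 0.
Proof. by case: _ / e. Qed.

(** * Invertibility of the block matrix and independence of its rows *)

Section MatrixA.
Variables (L : fieldExtType 'F_2) (N s p : nat) (alpha : 'I_N -> L) (b : p.-tuple L).
Hypothesis N_def : N.+1 = (2 ^ p)%N.
Hypothesis alpha_inj : injective alpha.
Hypothesis alpha_nz : forall x : L, x != 0 <-> exists k, alpha k = x.
Hypothesis b_basis : basis_of fullv b.

Local Notation U := (Umx s alpha b).
Local Notation A := (Amx s alpha b).

Lemma UmxE k t i : U k (mxvec_index t i) = coord b i (alpha k ^+ t.+1).
Proof. by rewrite mxE mxvecE mxE. Qed.

Lemma trU_mul_U : (s * 2 ^ p./2 + s < N)%N -> U^T *m U = 0.
Proof.
move=> sN; apply/matrixP => c1 c2; rewrite [RHS]mxE mxE.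
case/mxvec_indexP: c1 => t i; case/mxvec_indexP: c2 => t' j.
rewrite -[RHS](coord_orthogonal N_def alpha_inj alpha_nz b_basis i j sN (ltn_ord t) (ltn_ord t')).
by apply: eq_bigr => k _; rewrite [in X in X * _]mxE !UmxE.
Qed.

(** A left kernel vector [(x, y)] satisfies [y = - x U] and [x = x U U^T]; then
    [x U = x U (U^T U) = 0], so both parts vanish. *)
Lemma Amx_unit : (s * 2 ^ p./2 + s < N)%N -> A \in unitmx.
Proof.
move=> sN; rewrite -row_free_unit; apply: inj_row_free => v.
rewrite /Amx mulmx_castmx_col => /castmx_col0.
rewrite -[v]hsubmxK; set x := lsubmx v; set y := rsubmx v.
rewrite mul_row_block !mulmx1 => /eqP; rewrite -row_mx0 => /eqP/eq_row_mx[e1 e2].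
have yE : y = - (x *m U) by apply/eqP; rewrite -addr_eq0 addrC e1.
have xE : x = x *m U *m U^T by apply/eqP; rewrite -subr_eq0 -mulNmx -yE e2.
have xU0 : x *m U = 0 by rewrite xE -!mulmxA trU_mul_U ?mulmx0.
by rewrite yE xU0 oppr0 xE xU0 mul0mx row_mx0.
Qed.

Definition row_y k : 'I_(N + s * p) := lshift (s * p) k.
Definition col_b k : 'I_(N + s * p) := cast_ord (addnC (s * p) N) (rshift (s * p) k).
Definition col_a c : 'I_(N + s * p) := cast_ord (addnC (s * p) N) (lshift N c).

Lemma row_y_inj : injective row_y.
Proof. exact: lshift_inj. Qed.

Lemma col_b_inj : injective col_b.
Proof. by move=> k j /cast_ord_inj/rshift_inj. Qed.

Lemma col_a_notin c : col_a c \notin codom col_b.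
Proof.
by apply/codomP => -[k /cast_ord_inj /eqP]; rewrite eq_lrshift.
Qed.

Lemma Amx_yb k j : A (row_y k) (col_b j) = (k == j)%:R.
Proof. by rewrite castmxE cast_ord_id cast_ordK block_mxEur mxE. Qed.

Lemma Amx_ya k c : A (row_y k) (col_a c) = U k c.
Proof. by rewrite castmxE cast_ord_id cast_ordK block_mxEul. Qed.

Lemma Amx_wb c k : A (rshift N c) (col_b k) = U k c.
Proof. by rewrite castmxE cast_ord_id cast_ordK block_mxEdr mxE. Qed.

Lemma U_rows_independent (J : {set 'I_N}) : J != set0 -> (#|J| <= s)%N ->
  exists c, \sum_(k in J) U k c != 0.
Proof.
move=> J0 Js; have [t ts nz] := powers_independent alpha_inj alpha_nz J0 Js.
have [i nzi] : exists i, coord b i (\sum_(k in J) alpha k ^+ t.+1) != 0.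
  have [i nzi|no] := pickP (fun i => coord b i (\sum_(k in J) alpha k ^+ t.+1) != 0); first by exists i.
  case/eqP: nz; rewrite [LHS](coord_sum b_basis) big1 // => i _.
  by have := no i => /negbFE/eqP ->; rewrite scale0r.
exists (mxvec_index (Ordinal ts) i); move: nzi; rewrite linear_sum.
by under [X in _ -> X != 0]eq_bigr => k _ do rewrite UmxE.
Qed.

Lemma Amx_product_bound k h l : (0 < s)%N -> (0 < h)%N ->
  is_product (two_local_gates (N + s * p)) A k ->
  (N + s * p + k < 2 ^ l)%N ->
  (3 * ((2 * (h * l) + 3) * (3 * 2 ^ h)) <= s)%N ->
  (4 * h * (N + s * p) <= 9 * h * (s * p) + h * k + 3 * (N + s * p + k))%N.
Proof.
move=> s0 h0 prod_k ltl les.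
have := @two_local_lower_bound _ A k N s row_y col_b h l prod_k row_y_inj col_b_inj Amx_yb s0.
rewrite addKn; apply=> // [J J0 Js|k'].
  have [c nz] := U_rows_independent J0 Js; exists (col_a c); first exact: col_a_notin.
  by under eq_bigr => i _ do rewrite Amx_ya.
have [||c] := @U_rows_independent [set k']; rewrite ?cards1 //.
  by apply/set0Pn; exists k'; rewrite inE.
rewrite big_set1 => nz; exists (rshift N c); last by rewrite Amx_wb.
by apply/codomP => -[j /eqP]; rewrite eq_rlshift.
Qed.

End MatrixA.

(** * Asymptotics *)

Section Sizes.
Variables h p N s : nat.
Hypothesis h_def : h = (p %/ 12)%N.
Hypothesis h_ge : (11 <= h)%N.
Hypothesis N_def : N.+1 = (2 ^ p)%N.
Hypothesis s_lb : (N <= s ^ 3)%N.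
Hypothesis s_ub : (s ^ 3 <= 8 * N)%N.

Lemma p_bounds : (12 * h <= p < 12 * h.+1)%N.
Proof. by rewrite h_def; lia. Qed.

Lemma N_ge : (2 ^ p.-1 <= N)%N.
Proof.
have /andP[p1 _] := p_bounds.
have e : (2 ^ p = 2 * 2 ^ p.-1)%N by rewrite -expnS prednK //; lia.
have : (0 < 2 ^ p.-1)%N by rewrite expn_gt0.
by move: N_def; rewrite e; move: (2 ^ p.-1)%N => u; clear; lia.
Qed.

Lemma h_lt_exp : (h.+1 <= 2 ^ h)%N.
Proof. exact: ltn_expl. Qed.

Lemma dependency_size : (3 * ((2 * (h * (p + 4)) + 3) * (3 * 2 ^ h)) <= s)%N.
Proof.
rewrite -(@leq_exp2r _ _ 3) //; apply: leq_trans s_lb; apply: leq_trans N_ge.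
have /andP[p1 p2] := p_bounds.
(* The left side is at most [9 * 57 * 2 ^ (3 * h)], and [9 * 57 = 513 <= 2 ^ 10]. The last
   comparison, [3 * (10 + 3 * h) <= p.-1], follows from [12 * h <= p] and [11 <= h]. *)
apply: (@leq_trans ((2 ^ (10 + 3 * h)) ^ 3)).
  rewrite leq_exp2r // expnD mulnC -mulnA.
  have -> : (3 * 2 ^ h * 3 = 9 * 2 ^ h)%N by lia.
  have := h_lt_exp => lth.
  have : (2 * (h * (p + 4)) + 3 <= 57 * (2 ^ h * 2 ^ h))%N.
    apply: (@leq_trans (57 * (h.+1 * h.+1))); last by rewrite leq_mul2l leq_mul.
    by nia.
  move=> le1; rewrite (_ : 3 * h = h + (h + h))%N; last by lia.
  rewrite !expnD (_ : 2 ^ 10 = 1024)%N //.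
  by move: le1; set a := (2 ^ h)%N; set c := (2 * _ + 3)%N; nia.
by rewrite -expnM leq_exp2l //; lia.
Qed.

Lemma s_small : (p * p * s <= N)%N.
Proof.
have /andP[p1 p2] := p_bounds; have lth := h_lt_exp.
rewrite -(@leq_exp2r _ _ 3) // expnMn; apply: leq_trans (leq_mul (leqnn _) s_ub) _.
rewrite mulnA [in leqRHS]expnS mulnC leq_mul2l; apply/orP; right.
apply: (@leq_trans ((2 ^ p.-1) ^ 2)); last by rewrite leq_exp2r // N_ge.
have lp : (p <= 2 ^ (4 + h))%N.
  by rewrite expnD (_ : 2 ^ 4 = 16)%N //; lia.
apply: (@leq_trans ((2 ^ (4 + h) * 2 ^ (4 + h)) ^ 3 * 8)).
  by rewrite leq_mul2r leq_exp2r // leq_mul.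
by rewrite -expnD -!expnM (_ : 8 = 2 ^ 3)%N // -expnD leq_exp2l //; lia.
Qed.

Lemma orthogonality_size : (s * 2 ^ p./2 + s < N)%N.
Proof.
have /andP[p1 p2] := p_bounds.
rewrite -(@ltn_exp2r _ _ 3) // -{2}[s]muln1 -mulnDr expnMn.
apply: leq_ltn_trans (leq_mul s_ub (leqnn _)) _.
rewrite [in ltnRHS]expnS -mulnA mulnCA ltn_mul2l.
have N0 : (0 < N)%N by apply: leq_trans N_ge; rewrite expn_gt0.
rewrite N0 /=; apply: leq_trans (_ : (2 ^ p.-1) ^ 2 <= _)%N; last by rewrite leq_exp2r // N_ge.
apply: (@leq_ltn_trans (2 ^ 3 * (2 ^ (p./2).+1) ^ 3)).
  rewrite leq_mul2l leq_exp2r // expnS; have : (0 < 2 ^ p./2)%N by rewrite expn_gt0.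
  by lia.
by rewrite -!expnM -expnD ltn_exp2l //; have := odd_double_half p; lia.
Qed.

(** By [s_small], [N + s * p] is at most [2 * N], so the sum is below [10 * N]; this gives the
    exponent [p + 4]. *)
Lemma total_size k : (k < 4 * (N + s * p))%N -> (N + s * p + k < 2 ^ (p + 4))%N.
Proof.
have /andP[p1 p2] := p_bounds.
have : (s * p <= N)%N by apply: leq_trans s_small; rewrite mulnC leq_mul2r; apply/orP; right; nia.
by rewrite expnD -N_def (_ : 2 ^ 4 = 16)%N //; lia.
Qed.

End Sizes.

(* Imported only now because classical_sets shadows names of finset. *)
From mathcomp Require Import all_classical all_reals all_analysis.
Import numFieldNormedType.Exports.

Lemma gate_length_product n (S : {set 'M['F_2]_n}) A :
  (exists k, is_product S A k) -> is_product S A (gate_length S A).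
Proof.
by rewrite /gate_length => ex; case: pselect => // h; case: ex_minnP.
Qed.

Lemma is_productS n (S1 S2 : {set 'M['F_2]_n}) A k :
  {subset S1 <= S2} -> is_product S1 A k -> is_product S2 A k.
Proof.
move=> sub /is_productP[gs sz [s1 pA]]; apply/is_productP; exists gs => //.
by split=> // g /s1/sub.
Qed.

(** The cube root [x] is at least 1, so its ceiling is below [x + 1 <= 2 * x]; hence the factor
    8. *)
Lemma dims_cube (R : realType) p : (0 < dimN p)%N ->
  (dimN p <= dims R p ^ 3)%N /\ (dims R p ^ 3 <= 8 * dimN p)%N.
Proof.
rewrite /dims; set N := dimN p => N0; set x : R := _ `^ _.
have x0 : 0 <= x by apply: powR_ge0.
have x3 : x ^+ 3 = N%:R by rewrite -powR_mulrn // -powRrM mulVf ?powRr1.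
have x1 : 1 <= x.
  rewrite -(@ler_pXn2r _ 3) ?nnegrE // x3 expr1n; by rewrite ler1n.
have sE : (`|Num.ceil x|%N)%:R = (Num.ceil x)%:~R :> R.
  by rewrite natr_absz ger0_norm // ceil_ge0 (lt_le_trans _ x0) // ltrN10.
have lo := ceil_ge x; have hi := ceilB1_lt x; rewrite -sE in lo; rewrite intrB -sE in hi.
set s := `|_|%N in lo hi *; split.
  by rewrite -(ler_nat R) natrX -x3 ler_pXn2r ?nnegrE.
rewrite -(ler_nat R) natrX natrM -x3 (_ : 8%:R = 2%:R ^+ 3); last by rewrite -natrX.
rewrite -exprMn ler_pXn2r ?nnegrE ?mulr_ge0 //.
by have h1 : s%:R - 1 < x by []; lra.
Qed.

Lemma real_bound (R : realType) (h r k m : nat) : (0 < h)%N ->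
  (4 * h * m <= 9 * h * r + h * k + 15 * m)%N ->
  4 * m%:R - (9 * r%:R + 15 * m%:R / h%:R) <= k%:R :> R.
Proof.
move=> h0 le1; have hR : 0 < h%:R :> R by rewrite ltr0n.
rewrite lerBlDr -(ler_pM2l hR) !mulrDr [_ * (15 * _ / _)]mulrC mulfVK ?gt_eqF //.
by rewrite -(ler_nat R) !natrD !natrM in le1; lra.
Qed.

Local Open Scope classical_set_scope.

(** [p %/ 12] is the parameter [h]: it tends to infinity, while [2 ^ h] times a polynomial in [p]
    stays below [s], which is about [2 ^ (p / 3)]. *)
Definition error (R : realType) p : R :=
  9 * (dims R p * p)%:R + 15 * (dimm R p)%:R / (p %/ 12)%:R.

Lemma sizes (R : realType) p : (144 <= p)%N ->
  [/\ (11 <= p %/ 12)%N, (dimN p).+1 = (2 ^ p)%N,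
      (dimN p <= dims R p ^ 3)%N & (dims R p ^ 3 <= 8 * dimN p)%N].
Proof.
move=> p_ge; have N_def : (dimN p).+1 = (2 ^ p)%N.
  by rewrite /dimN subn1 prednK // expn_gt0.
have N0 : (0 < dimN p)%N by rewrite -ltnS N_def -{1}(expn0 2) ltn_exp2l //; lia.
by have [lo hi] := dims_cube R N0; split=> //; lia.
Qed.

Lemma error_little_o (R : realType) : @error R =o_\oo (fun p => (dimm R p)%:R : R).
Proof.
apply/eqoP => eps eps0; near=> p.
have p_ge : (144 <= p)%N by near: p; exact: nbhs_infty_ge.
(* [369 = 9 + 15 * 24]: by [m_ge] the first term of the error is at most [9 * m / p], and by [hp]
   the second is at most [360 * m / p]. *)
have peps : 369 / eps <= p%:R by near: p; exact: nbhs_infty_ger.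
have [h_ge N_def lo hi] := sizes R p_ge.
have sp := s_small (erefl _) h_ge N_def lo hi.
have m_ge : p%:R * (dims R p * p)%:R <= (dimm R p)%:R :> R.
  by rewrite -natrM ler_nat (leq_trans _ (leq_addr _ _)) // mulnCA mulnC.
have p0 : 0 < p%:R :> R by rewrite ltr0n; lia.
have h0 : 0 < (p %/ 12)%:R :> R by rewrite ltr0n; lia.
have hp : p%:R <= 24 * (p %/ 12)%:R :> R by rewrite -natrM ler_nat; lia.
rewrite /error; set m : R := (dimm R p)%:R in m_ge *; set r : R := (dims R p * p)%:R in m_ge *.
have m0 : 0 <= m by apply: ler0n.
have r0 : 0 <= r by apply: ler0n.
rewrite !ger0_norm ?addr_ge0 ?mulr_ge0 ?divr_ge0 ?invr_ge0 ?(ltW h0) //.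
have e1 : 15 * m / (p %/ 12)%:R <= 360 * m / p%:R.
  rewrite ler_pdivrMr // mulrAC ler_pdivlMr //.
  by nra.
have e2 : 9 * r <= 9 * m / p%:R by rewrite ler_pdivlMr // -mulrA ler_pM2l // mulrC.
apply: le_trans (lerD e2 e1) _.
rewrite -mulrDl ler_pdivrMr //.
move: peps; rewrite ler_pdivrMr // => peps.
by nra.
Unshelve. all: by end_near.
Qed.

Theorem theorem2p8 (R : realType) :
  exists e1 e2 : nat -> R,
    [/\ e1 =o_\oo (fun p => (dimm R p)%:R : R),
        e2 =o_\oo (fun p => (dimm R p)%:R : R) &
        \forall p \near \oo,
          forall (L : fieldExtType 'F_2) (alpha : 'I_(dimN p) -> L)
                 (b : p.-tuple L),
            #|{: finvect_type L}| = (2 ^ p)%N ->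
            injective alpha ->
            (forall x : L, x != 0 <-> exists k, alpha k = x) ->
            basis_of fullv b ->
            let A : 'M['F_2]_(dimm R p) := Amx (dims R p) alpha b in
            [/\ A \in unitmx,
                (two_local_length A)%:R >= 4 * (dimm R p)%:R - e1 p &
                (cnot_length A)%:R >= 4 * (dimm R p)%:R - e2 p]].
Proof.
exists (@error R), (@error R); split; [exact: error_little_o|exact: error_little_o|].
near=> p => L alpha b _ alpha_inj alpha_nz b_basis.
set A : 'M['F_2]_(dimm R p) := Amx _ _ _.
have p_ge : (144 <= p)%N by near: p; exact: nbhs_infty_ge.
have [h_ge N_def lo hi] := sizes R p_ge.
have s_orth := orthogonality_size (erefl _) h_ge N_def lo hi.
have s_dep := dependency_size (erefl _) h_ge N_def lo hi.
have uA : A \in unitmx := Amx_unit N_def alpha_inj alpha_nz b_basis s_orth.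
have h0 : (0 < p %/ 12)%N by lia.
have s0 : (0 < dims R p)%N by apply: leq_trans s_dep; rewrite !muln_gt0 expn_gt0 addn3.
have bound k : is_product (two_local_gates (dimm R p)) A k ->
    4 * (dimm R p)%:R - error R p <= k%:R.
  move=> prod_k; rewrite /error; set m := dimm R p.
  have hR : 0 < (p %/ 12)%:R :> R by rewrite ltr0n.
  rewrite lerBlDr.
  (* Products of at least [4 * m] gates satisfy the bound trivially; for the others
     [3 * (m + k) <= 15 * m], and [total_size] applies. *)
  have [k_ge|k_lt] := leqP (4 * m) k.
    have : 4 * m%:R <= k%:R :> R by rewrite -natrM ler_nat.
    by move=> /le_trans; apply; rewrite lerDl addr_ge0 // ?divr_ge0 ?mulr_ge0 // ltW.
  have ltl := total_size (erefl _) h_ge N_def lo hi k_lt.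
  have := Amx_product_bound alpha_inj alpha_nz b_basis s0 h0 prod_k ltl s_dep.
  rewrite -/(dimm R p) -/m => le1.
  have {le1}le1 : (4 * (p %/ 12) * m <= 9 * (p %/ 12) * (dims R p * p) + (p %/ 12) * k + 15 * m)%N.
    by apply: leq_trans le1 _; rewrite leq_add2l; lia.
  by rewrite -lerBlDr; apply: real_bound.
have ex : exists k, is_product (transvections (dimm R p)) A k := transvections_generate uA.
split=> //.
- apply: bound; apply: gate_length_product.
  by case: ex => k prod_k; exists k; apply: is_productS prod_k; exact: transvection_two_local.
(* A product of transvections is a product of two-local gates, so the same bound covers the CNOT
   length. *)
- apply: bound; apply: (is_productS (@transvection_two_local _)).
  exact: gate_length_product.
Unshelve. all: by end_near.
Qed.
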